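(* Let $D$ be a weighted oriented graph. Then the set $\mathcal{C}_D$ of all circuit binomials of $I_D$ (binomials being identified up to sign) is $$\begin{aligned}\mathcal{C}_D=\;&\{f_{\mathbf c} : \mathcal C \text{ is a balanced cycle in } D\}\\ &\cup\{f_{\mathbf{c}_i\cup \mathbf{c}_j} : \mathcal C_i,\mathcal C_j \text{ are unbalanced cycles sharing a vertex in } D\}\\ &\cup\{f_{\mathbf{c}_i\mathbf{p}\mathbf{c}_j} : \mathcal C_i,\mathcal C_j \text{ are unbalanced cycles sharing a path } P \text{ in } D\}\\ &\cup\{f_{\mathbf{c}_i\cup\mathbf{p}\cup\mathbf{c}_j} : \mathcal C_i,\mathcal C_j \text{ are unbalanced cycles connected by a path } P \text{ in } D\}.\end{aligned}$$
   Context: $K$ is a field. A weighted oriented graph $D=(V(D),E(D),\mathbf w)$ is a finite graph without loops or parallel edges on $V(D)=\{x_1,\dots,x_n\}$, each edge being given an orientation ($(x_i,x_j)$ denotes an edge from $x_i$ to $x_j$), together with a weight function $\mathbf w:V(D)\to\{1,2,\dots\}$; put $w_i=\mathbf w(x_i)$. Write $E(D)=\{e_1,\dots,e_m\}$. The incidence matrix $A(D)$ is the $n\times m$ matrix whose $(i,j)$ entry is $1$ if $e_j=(x_i,x_l)$ for some $l$, $w_i$ if $e_j=(x_l,x_i)$ for some $l$, and $0$ otherwise. The toric ideal $I_D$ is the kernel of the $K$-algebra homomorphism $K[e_1,\dots,e_m]\to K[x_1,\dots,x_n]$ sending $e_j=(x_i,x_l)$ to $x_ix_l^{w_l}$. The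 support of a binomial is the set of variables $e_i$ occurring in it. A circuit binomial of $I_D$ is an irreducible nonzero binomial $\mathbf e^{\mathbf u}-\mathbf e^{\mathbf v}\in I_D$ whose support is minimal with respect to inclusion among supports of nonzero binomials of $I_D$. A nonzero binomial $\mathbf e^{\mathbf u}-\mathbf e^{\mathbf v}\in I_D$ is primitive if there is no other nonzero binomial $\mathbf e^{\mathbf u'}-\mathbf e^{\mathbf v'}\in I_D$ with $\mathbf e^{\mathbf u'}\mid\mathbf e^{\mathbf u}$ and $\mathbf e^{\mathbf v'}\mid\mathbf e^{\mathbf v}$. Cycles and paths in $D$ are those of the underlying undirected graph, with the inherited orientations and weights; each is itself a weighted oriented graph. An (even) cycle $\mathcal C$ is balanced if $\det A(\mathcal C)=0$; a cycle that is not balanced is unbalanced (odd cycles always have $\det A(\mathcal C)\ne0$). For a subgraph $H$ of $D$, $I_H\subseteq K[e: e\in E(H)]\subseteq K[e_1,\dots,e_m]$. Two cycles share a vertex if their intersection is exactly one vertex; they share a path $P$ if their intersection is exactly a path $P$ of length $\ge1$ (so that the edges of $\mathcal C_i\cup\mathcal C_j$ not in $P$ form a cycle, the outer cycle); they are connected by a path $P$ if they are vertex-disjoint and $P$ is a path of length $\ge 1$ meeting $\mathcal C_i\cup\mathcal C_j$ exactly in its two endpoints, one on each cycle. It is known that the following toric ideals are principal, and the notation for their primitive binomial generators (unique up to sign) is: $f_{\mathbf c}$ generates $I_{\mathcal C}$ for a balanced cycle $\mathcal C$; $f_{\mathbf c_i\cup\mathbf c_j}$ generates $I_{\mathcal C_i\cup\mathcal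 C_j}$ for unbalanced cycles sharing a vertex; $f_{\mathbf c_i\mathbf p\mathbf c_j}$ generates $I_{\mathcal C_i\cup\mathcal C_j}$ for unbalanced cycles sharing a path $P$; $f_{\mathbf c_i\cup\mathbf p\cup\mathbf c_j}$ generates $I_{\mathcal C_i\cup P\cup\mathcal C_j}$ for unbalanced cycles connected by a path $P$. *)

(* Defs.v *)
From HB Require Import structures.
From mathcomp Require Import all_boot all_order all_algebra.
From mathcomp.multinomials Require Import mpoly.
From Stdlib Require Import ClassicalEpsilon.

Set Implicit Arguments.
Unset Strict Implicit.
Unset Printing Implicit Defensive.

Import GRing.Theory.
Local Open Scope ring_scope.

(* Edge e is oriented from [src e] to [tgt e].  The underlying undirected graph
   is simple, so antiparallel pairs of edges are excluded as well. *)
Record wograph (n m : nat) := WOGraph {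
  src : 'I_m -> 'I_n;
  tgt : 'I_m -> 'I_n;
  weight : 'I_n -> nat;
  no_loop : forall e, src e != tgt e;
  no_parallel : forall e e',
    [set src e; tgt e] = [set src e'; tgt e'] -> e = e';
  weight_gt0 : forall x, (0 < weight x)%N
}.

Section Graph.
Variables (n m : nat) (D : wograph n m).

Definition incidence : 'M[int]_(n, m) :=
  \matrix_(i, e) if i == src D e then 1
                 else if i == tgt D e then (weight D i)%:Z else 0.

Definition joins (e : 'I_m) (x y : 'I_n) : Prop :=
  [set src D e; tgt D e] = [set x; y].

(* A cycle x_0, e_0, x_1, e_1, ..., x_(k-1), e_(k-1), x_0 of length k >= 3;
   [ordS] is the cyclic successor on 'I_k. *)
Record wcycle := WCycle {
  clen : nat;
  cvtx : 'I_clen -> 'I_n;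
  cedge : 'I_clen -> 'I_m;
  clen_gt2 : (2 < clen)%N;
  cvtx_inj : injective cvtx;
  cedgeP : forall i, joins (cedge i) (cvtx i) (cvtx (ordS i))
}.

(* A path x_0, e_0, x_1, ..., e_(k-1), x_k of length k. *)
Record wpath := WPath {
  plen : nat;
  pvtx : 'I_plen.+1 -> 'I_n;
  pedge : 'I_plen -> 'I_m;
  pvtx_inj : injective pvtx;
  pedgeP : forall i : 'I_plen,
    joins (pedge i) (pvtx (widen_ord (leqnSn plen) i)) (pvtx (lift ord0 i))
}.

Definition cycle_verts (C : wcycle) : {set 'I_n} := [set cvtx i | i : 'I_(clen C)].
Definition cycle_edges (C : wcycle) : {set 'I_m} := [set cedge i | i : 'I_(clen C)].
Definition path_verts (P : wpath) : {set 'I_n} := [set pvtx i | i : 'I_(plen P).+1].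
Definition path_edges (P : wpath) : {set 'I_m} := [set pedge i | i : 'I_(plen P)].

(* Since orientations and weights are inherited, the incidence matrix of a
   cycle is the submatrix of the one of D on the vertices and edges of C; the
   enumeration chosen only affects the sign of its determinant. *)
Definition cycle_incidence (C : wcycle) : 'M[int]_(clen C) :=
  mxsub (@cvtx C) (@cedge C) incidence.

Definition balanced (C : wcycle) : Prop := \det (cycle_incidence C) = 0.
Definition unbalanced (C : wcycle) : Prop := ~ balanced C.

Definition share_vertex (C1 C2 : wcycle) : Prop :=
  exists x, cycle_verts C1 :&: cycle_verts C2 = [set x].

Definition share_path (C1 C2 : wcycle) (P : wpath) : Prop :=
  [/\ (0 < plen P)%N,
      cycle_verts C1 :&: cycle_verts C2 = path_verts P &
      cycle_edges C1 :&: cycle_edges C2 = path_edges P].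

Definition connected_by (C1 C2 : wcycle) (P : wpath) : Prop :=
  [/\ (0 < plen P)%N,
      [disjoint cycle_verts C1 & cycle_verts C2],
      @pvtx P ord0 \in cycle_verts C1,
      @pvtx P ord_max \in cycle_verts C2 &
      path_verts P :&: (cycle_verts C1 :|: cycle_verts C2)
        = [set @pvtx P ord0; @pvtx P ord_max]].

End Graph.

Section Toric.
Variables (K : fieldType) (n m : nat) (D : wograph n m).
Implicit Types (f g p q : {mpoly K[m]}) (F : {set 'I_m}).

Definition msupport p : {set 'I_m} :=
  [set i | has (fun u : 'X_{1..m} => u i != 0%N) (msupp p)].

Definition toric_map p : {mpoly K[n]} :=
  p \mPo [tuple 'X_(src D e) * 'X_(tgt D e) ^+ weight D (tgt D e) | e < m].

Definition toric_ideal p : Prop := toric_map p = 0.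

(* I_H for a subgraph H with edge set F, an ideal of K[e : e in F] seen inside
   K[e_1, ..., e_m]. *)
Definition toric_ideal_sub F p : Prop := msupport p \subset F /\ toric_ideal p.

Definition nonzero_binomial f : Prop :=
  f <> 0 /\ exists u v : 'X_{1..m}, f = 'X_[u] - 'X_[v].

Definition irreducible_mpoly f : Prop :=
  [/\ f <> 0, f \isn't a GRing.unit &
      forall g h, f = g * h -> g \is a GRing.unit \/ h \is a GRing.unit].

Definition circuit f : Prop :=
  [/\ nonzero_binomial f, toric_ideal f, irreducible_mpoly f &
      forall g, nonzero_binomial g -> toric_ideal g ->
        msupport g \subset msupport f -> msupport g = msupport f].

(* On monomials, (u' <= u)%MM is divisibility. *)
Definition primitive (I : {mpoly K[m]} -> Prop) f : Prop :=
  exists u v : 'X_{1..m},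
    [/\ f = 'X_[u] - 'X_[v], f <> 0, I f &
        forall u' v' : 'X_{1..m},
          'X_[u'] - 'X_[v'] <> 0 :> {mpoly K[m]} -> I ('X_[u'] - 'X_[v']) ->
          (u' <= u)%MM -> (v' <= v)%MM ->
          'X_[u'] - 'X_[v'] = f].

Definition generates F f : Prop :=
  forall p, toric_ideal_sub F p <->
    exists q, msupport q \subset F /\ p = q * f.

(* The primitive binomial generator of I_H, for H with edge set F; it is
   determined up to sign when I_H is principal and nonzero, and is an
   arbitrary polynomial when no such generator exists. *)
Definition toric_gen F : {mpoly K[m]} :=
  epsilon (inhabits 0)
    (fun f => primitive (toric_ideal_sub F) f /\ generates F f).

Definition eq_up_to_sign f g : Prop := f = g \/ f = - g.

End Toric.

(* Main.v *)
(* A binomial e^u - e^v lies in I_D iff u - v is in the integer kernel of A(D).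
   If the kernel vectors supported on an edge set F form a lattice Z z, then I_F
   is generated by e^(z+) - e^(z-); being the kernel of a map to a domain, I_F
   is prime, so this generator is irreducible, and it is a circuit because it
   divides every binomial of I_F.

   For two unbalanced cycles, possibly joined by a path, the transpose of A is
   injective (unbalanced cycles kill the functions on their vertices) and there
   is exactly one more edge than there are vertices, so the kernel has rank 1; for
   a balanced cycle a kernel vector is determined by one of its entries.

   Conversely, every vertex meeting the support S of a nonzero kernel vector z
   has degree at least 2 in S.  If S contains no balanced cycle, take a cycle C in
   S: some edge of S leaves C, as otherwise z restricted to C would be in the
   kernel of the nonsingular A(C).  A maximal walk along this edge comes back to C
   or to itself, which gives one of the three configurations inside S.  Its
   generator has the support of the given circuit and divides it, so the two agree
   up to sign. *)
Require Import Defs.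
From mathcomp Require Import all_boot all_order all_algebra zify.
From mathcomp.multinomials Require Import mpoly.
From Stdlib Require Import ClassicalEpsilon.

Set Implicit Arguments.
Unset Strict Implicit.
Unset Printing Implicit Defensive.

Import Order.TTheory GRing.Theory Num.Theory.
Local Open Scope ring_scope.

(** * Supports of polynomials and of their products *)

Section SupportMultiplicative.
Variables (K : fieldType) (m : nat).
Implicit Types (p q f g : {mpoly K[m]}) (F : {set 'I_m}).

Lemma msupportP p i :
  reflect (exists2 u, u \in msupp p & u i != 0%N) (i \in msupport p).
Proof. by rewrite inE; apply: hasP. Qed.

Lemma msupport_subP F p :
  reflect {in msupp p, forall (u : 'X_{1..m}) i, i \notin F -> u i = 0%N} (msupport p \subset F).
Proof.
apply: (iffP subsetP) => [sF u pu i iF | sF i /msupportP[u pu]].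
  apply/eqP; apply: contraNT iF => ui; apply: sF.
  by apply/msupportP; exists u.
by apply: contraR => iF; rewrite (sF u pu i iF).
Qed.

Lemma msupportX (u : 'X_{1..m}) F :
  reflect (forall i, i \notin F -> u i = 0%N) (msupport 'X_[K, u] \subset F).
Proof.
apply: (iffP (msupport_subP _ _)) => [h | h v].
  by apply: h; rewrite msuppX mem_seq1.
by rewrite msuppX mem_seq1 => /eqP->.
Qed.

Lemma msupport0 : msupport (0 : {mpoly K[m]}) = set0.
Proof. by apply/eqP; rewrite -subset0; apply/msupport_subP => u; rewrite msupp0. Qed.

Lemma msupportB F p q :
  msupport p \subset F -> msupport q \subset F -> msupport (p - q) \subset F.
Proof.
move=> /msupport_subP sp /msupport_subP sq; apply/msupport_subP => u.
by move/msuppB_le; rewrite mem_cat => /orP[/sp|/sq].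
Qed.

Lemma msupportZ F c p : msupport p \subset F -> msupport (c *: p) \subset F.
Proof.
by move=> /msupport_subP sp; apply/msupport_subP => u /msuppZ_le /sp.
Qed.

Lemma msupportM_sub F p q :
  msupport p \subset F -> msupport q \subset F -> msupport (p * q) \subset F.
Proof.
move=> /msupport_subP sp /msupport_subP sq; apply/msupport_subP => u.
move/msuppM_le => /allpairsP[[v w] /= [/sp pv /sq qw ->]] i iF.
by rewrite mnmDE pv ?qw.
Qed.

(* The substitution x_i := x_i T turns the degree in x_i into a degree in T. *)
Definition grade_var (i : 'I_m) p : {poly {mpoly K[m]}} :=
  mmap (polyC \o @mpolyC m K)
       (fun j => ('X_j)%:P * 'X ^+ (j == i)) p.

Lemma grade_varX i (u : 'X_{1..m}) : grade_var i 'X_[u] = ('X_[u])%:P * 'X ^+ u i.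
Proof.
rewrite /grade_var mmapX /mmap1 [in RHS]mpolyXE_id rmorph_prod /=.
rewrite (eq_bigr (fun j => ('X_j ^+ u j)%:P * 'X ^+ ((j == i) * u j))); last first.
  by move=> j _; rewrite exprMn -exprM rmorphXn.
rewrite big_split /=; congr (_ * _).
rewrite (bigD1 i) //= eqxx mul1n big1 ?mulr1 // => j /negPf->.
by rewrite mul0n.
Qed.

Lemma mcoeff_grade_var i p k (v : 'X_{1..m}) :
  ((grade_var i p)`_k)@_v = p@_v *+ (v i == k).
Proof.
rewrite [p in LHS]mpolyE /grade_var raddf_sum coef_sum raddf_sum /=.
under eq_bigr => u _.
  rewrite mmapZ /= -/(grade_var i 'X_[u]) grade_varX mulrA -polyCM coefCM coefXn.
  rewrite mulr_natr raddfMn /= mcoeffCM mcoeffX.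
over.
have [pv|pv] := boolP (v \in msupp p); last first.
  rewrite memN_msupp_eq0 // mul0rn big1_seq // => u /andP[_ pu].
  by case: eqP pv => [<-|_ _]; rewrite ?pu // mulr0 mul0rn.
rewrite (bigD1_seq v) //= eqxx mulr1 big1 ?addr0 1?eq_sym // => u /negPf->.
by rewrite mulr0 mul0rn.
Qed.

Lemma notin_msupport p i : (i \notin msupport p) = (size (grade_var i p) <= 1)%N.
Proof.
apply/idP/idP => [ip | sz].
  apply/leq_sizeP => k k0; apply/mpolyP => v; rewrite mcoeff_grade_var mcoeff0.
  case: eqP => // vk; rewrite memN_msupp_eq0 //; apply: contra ip => pv.
  by apply/msupportP; exists v; rewrite // vk -lt0n.
apply/msupportP => -[u pu u0].
have /leq_sizeP/(_ (u i)) := sz; rewrite lt0n => /(_ u0) /(congr1 (mcoeff u)).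
rewrite mcoeff_grade_var eqxx mcoeff0 => /eqP.
by rewrite mcoeff_eq0 pu.
Qed.

Lemma grade_var_eq0 i p : (grade_var i p == 0) = (p == 0).
Proof.
apply/eqP/eqP => [gp | ->]; last by rewrite /grade_var raddf0.
apply/mpolyP => v; move: (mcoeff_grade_var i p (v i) v).
by rewrite gp coef0 mcoeff0 eqxx.
Qed.

Lemma grade_varM i p q : grade_var i (p * q) = grade_var i p * grade_var i q.
Proof. exact: rmorphM. Qed.

(** In the grading by [i], the variable [i] is absent from a nonzero polynomial exactly when its
    image has degree 0 in T. These degrees add in a product, since the coefficients lie in a
    domain. *)
Lemma msupportM p q : p != 0 -> q != 0 ->
  msupport (p * q) = msupport p :|: msupport q.
Proof.
move=> p0 q0; apply/setP => i; apply/negb_inj.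
rewrite in_setU negb_or !notin_msupport.
rewrite grade_varM; move: p0 q0; rewrite -!(grade_var_eq0 i).
move: (grade_var i p) (grade_var i q) => a b a0 b0; rewrite size_mul //.
rewrite -!size_poly_gt0 in a0 b0; move: (size a) (size b) a0 b0 => k l k0 l0.
by case: k l k0 l0 => [|[|k]] [|[|l]] // _ _; rewrite ?addnS.
Qed.

Lemma binomial_neq0 (u v : 'X_{1..m}) : ('X_[K, u] - 'X_[v] == 0) = (u == v).
Proof.
rewrite subr_eq0; apply/eqP/eqP => [|->//] /(congr1 (mcoeff u)).
by rewrite !mcoeffX eqxx; case: eqVneq => // _ /eqP; rewrite oner_eq0.
Qed.

End SupportMultiplicative.

(** * Binomials of the toric ideal as integer kernel vectors *)

Section ToricGenerator.
Variables (K : fieldType) (n m : nat) (D : wograph n m).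
Implicit Types (p q f g : {mpoly K[m]}) (F : {set 'I_m}) (u v : 'X_{1..m}).
Implicit Types (y z : 'cV[int]_m).

Lemma incidenceE i e : incidence D i e =
  ((i == src D e)%:Z + (weight D (tgt D e))%:Z * (i == tgt D e)%:Z)%R.
Proof.
rewrite mxE; case: eqVneq => [->|_].
  by rewrite (negPf (no_loop D e)) mulr0 addr0.
by case: eqVneq => [->|_]; rewrite add0r ?mulr1 ?mulr0.
Qed.

(** The vector A(D) u computed in the naturals: the exponent of the image of the monomial with
    exponent [u]. *)
Definition vertex_exp u : 'X_{1..n} :=
  [multinom \sum_e ((i == src D e) + weight D (tgt D e) * (i == tgt D e)) * u e
   | i < n]%N.

Lemma toric_mapX u : toric_map D 'X_[K, u] = 'X_[vertex_exp u].
Proof.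
rewrite /toric_map comp_mpolyX.
rewrite (eq_bigr (fun e => 'X_[(U_(src D e) + U_(tgt D e) *+ weight D (tgt D e))
                                  *+ u e])); last first.
  by move=> e _; rewrite tnth_mktuple mpolyXn -mpolyXD mpolyXn.
rewrite -(big_morph _ (@mpolyXD n K) (@mpolyX0 n K)); congr ('X_[_]); apply/mnmP => i.
rewrite mnm_sumE mnmE; apply: eq_bigr => e _ /=.
by rewrite mulmnE mnmDE mulmnE !mnm1E ![_ == i]eq_sym [(weight _ _ * _)%N]mulnC.
Qed.

Definition exp_diff u v : 'cV[int]_m := \col_e ((u e)%:Z - (v e)%:Z).

Lemma vertex_exp_eq u v :
  (vertex_exp u = vertex_exp v) <-> incidence D *m exp_diff u v = 0.
Proof.
have vexp w i : (vertex_exp w i)%:Z = \sum_e incidence D i e * (w e)%:Z.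
  rewrite mnmE (big_morph Posz PoszD erefl); apply: eq_bigr => e _.
  by rewrite incidenceE PoszM PoszD PoszM.
have diff i : (incidence D *m exp_diff u v) i 0
    = (vertex_exp u i)%:Z - (vertex_exp v i)%:Z.
  rewrite !vexp mxE -sumrB; apply: eq_bigr => e _.
  by rewrite !mxE mulrBr.
split=> [uv | uv]; first by apply/colP => i; rewrite diff uv subrr mxE.
apply/mnmP => i; apply/eqP; rewrite -eqz_nat -subr_eq0 -diff uv mxE.
exact: eqxx.
Qed.

(* The exponent vectors u - v of the binomials of [toric_ideal_sub D F]. *)
Definition relation F z : Prop :=
  incidence D *m z = 0 /\ forall e, e \notin F -> z e 0 = 0.

(* The relations on F form a lattice of rank one: they are determined by a
   single coordinate. *)
Definition kernel_line F : Prop :=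
  exists2 z, relation F z & exists2 e, z e 0 != 0 &
    forall y, relation F y -> y e 0 = 0 -> y = 0.

Lemma relationB F k y z : relation F y -> relation F z -> relation F (y - k *: z).
Proof.
move=> [y0 yF] [z0 zF]; split; first by rewrite mulmxBr -scalemxAr y0 z0 scaler0 subr0.
by move=> e eF; rewrite !mxE yF ?zF // mulr0 subr0.
Qed.

(** Euclidean descent on the absolute value of the coordinate [e] of [z]: a relation whose
    coordinate is not a multiple of it leaves a remainder that is nonzero and smaller. Once every
    coordinate is a multiple, subtracting that multiple of [z] gives a relation vanishing at [e],
    hence zero. *)
Lemma kernel_line_basis F : kernel_line F ->
  exists z, [/\ z != 0, relation F z &
             forall y, relation F y -> exists k, y = k *: z].
Proof.
move=> [z zR [e ze inj]].
move: {2}(absz _) (leqnn (absz (z e 0))) => N.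
elim: N z zR ze => [|N IH] z zR ze leN.
  by move: leN; rewrite leqn0 absz_eq0 (negPf ze).
have [[y yR ndvd]|alldvd] :=
    excluded_middle_informative (exists2 y, relation F y & ~~ ((z e 0)%R %| (y e 0)%R)%Z).
  apply: (IH (y - ((y e 0)%R %/ (z e 0)%R)%Z *: z)); first exact: relationB.
    by rewrite !mxE -/(modz _ _); apply: contra ndvd => /eqP/dvdz_mod0P.
  rewrite -ltnS (leq_trans _ leN) // !mxE -/(modz _ _).
  by rewrite -ltz_nat gez0_abs ?modz_ge0 // abszE ltz_mod.
exists z; split=> //; first by apply: contraNneq ze => ->; rewrite mxE.
move=> y yR; have /dvdzP[k yk] : ((z e 0)%R %| (y e 0)%R)%Z.
  by apply/negPn/negP => nd; apply: alldvd; exists y.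
exists k; apply/eqP; rewrite -subr_eq0; apply/eqP/inj; first exact: relationB.
by rewrite !mxE yk subrr.
Qed.



Definition pos_exp z : 'X_{1..m} :=
  [multinom if (0 <= z e 0)%R then absz (z e 0)%R else 0%N | e < m].
Definition neg_exp z : 'X_{1..m} := pos_exp (- z).

Lemma pos_neg_exp z e : (pos_exp z e)%:Z - (neg_exp z e)%:Z = z e 0.
Proof.
by rewrite /neg_exp !mnmE mxE; move: (z e 0) => x; case: (leP 0 x); case: (leP 0 (- x)); lia.
Qed.

Lemma exp_diff_pos_neg z : exp_diff (pos_exp z) (neg_exp z) = z.
Proof. by apply/colP => e; rewrite mxE pos_neg_exp. Qed.

Lemma pos_neg_exp_disj z e : (pos_exp z e == 0%N) || (neg_exp z e == 0%N).
Proof.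
by rewrite /neg_exp !mnmE mxE; move: (z e 0) => x; case: (leP 0 x); case: (leP 0 (- x)); lia.
Qed.

Definition lattice_binomial z : {mpoly K[m]} := 'X_[pos_exp z] - 'X_[neg_exp z].

Lemma lattice_binomial_neq0 z : z != 0 -> lattice_binomial z != 0.
Proof.
rewrite binomial_neq0; apply: contraNneq => uv.
by rewrite -[z]exp_diff_pos_neg uv; apply/eqP/colP => e; rewrite !mxE subrr.
Qed.

Lemma toric_mapM p q : toric_map D (p * q) = toric_map D p * toric_map D q.
Proof. exact: rmorphM. Qed.

Lemma toric_mapB p q : toric_map D (p - q) = toric_map D p - toric_map D q.
Proof. exact: raddfB. Qed.

Lemma toric_mapZ c p : toric_map D (c *: p) = c *: toric_map D p.
Proof. exact: linearZ. Qed.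

Lemma toric_ideal_binomial u v :
  toric_ideal D ('X_[K, u] - 'X_[v]) <-> vertex_exp u = vertex_exp v.
Proof.
rewrite /toric_ideal toric_mapB !toric_mapX; split=> [/eqP|->]; last exact: subrr.
by rewrite binomial_neq0 => /eqP.
Qed.

Lemma relation_exp_diff F u v : vertex_exp u = vertex_exp v ->
    (forall e, e \notin F -> u e = 0%N) -> (forall e, e \notin F -> v e = 0%N) ->
  relation F (exp_diff u v).
Proof.
move=> /vertex_exp_eq uv uF vF; split=> // e eF.
by rewrite mxE uF ?vF // subrr.
Qed.

Lemma lattice_binomial_ideal F z : relation F z ->
  toric_ideal_sub D F (lattice_binomial z).
Proof.
move=> [z0 zF]; split; last first.
  by apply/toric_ideal_binomial/vertex_exp_eq; rewrite exp_diff_pos_neg.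
by apply: msupportB; apply/msupportX => e eF; rewrite mnmE ?mxE zF.
Qed.

(** With u and v the positive and negative parts of [z], X^a - X^b is a monomial times (X^u)^k -
    (X^v)^k, which is divisible by X^u - X^v. *)
Lemma binomial_multiple z k a b : 0 <= k -> exp_diff a b = k *: z ->
  exists q, 'X_[a] - 'X_[b] = q * lattice_binomial z.
Proof.
case: k => // k _ abz.
pose u := pos_exp z; pose v := neg_exp z.
have abE e : (a e)%:Z - (b e)%:Z = k%:Z * ((u e)%:Z - (v e)%:Z).
  by have /colP/(_ e) := abz; rewrite !mxE pos_neg_exp.
(* The truncated subtraction loses nothing: [u] and [v] have disjoint supports, so where [u e] is
   nonzero, [a e] is [b e] plus k times [u e]. *)
pose c := (a - u *+ k)%MM.
have cE e : a e = (c e + u e * k)%N /\ b e = (c e + v e * k)%N.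
  have := abE e; have := pos_neg_exp_disj z e; rewrite mnmBE mulmnE -/u -/v.
  nia.
have -> : a = (c + u *+ k)%MM.
  by apply/mnmP => e; rewrite mnmDE mulmnE; case: (cE e).
have -> : b = (c + v *+ k)%MM.
  by apply/mnmP => e; rewrite mnmDE mulmnE; case: (cE e).
rewrite !mpolyXD -!mpolyXn -mulrBr subrXX.
by eexists; rewrite mulrCA mulrC /lattice_binomial -/u -/v.
Qed.

Lemma binomial_in_lattice F z a b : 
    (forall y, relation F y -> exists k, y = k *: z) ->
    relation F (exp_diff a b) ->
  exists q, 'X_[a] - 'X_[b] = q * lattice_binomial z.
Proof.
move=> span /span[k abz]; have [k0|k0] := leP 0 k.
  exact: binomial_multiple abz.
have [||q qE] := @binomial_multiple z (- k) b a; first by rewrite oppr_ge0 ltW.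
  rewrite scaleNr -abz; apply/colP => e; rewrite !mxE opprB; exact.
by exists (- q); rewrite mulNr -qE opprB.
Qed.

(** Induction on the number of terms. The image of a monomial [a] of [p] has to cancel against that
    of another monomial [b], so a scalar multiple of X^a - X^b, itself a multiple of the lattice
    binomial, can be subtracted from [p]. *)
Lemma toric_ideal_sub_multiple F z p :
    (forall y, relation F y -> exists k, y = k *: z) ->
  toric_ideal_sub D F p -> exists q, p = q * lattice_binomial z.
Proof.
move=> span; move: {2}(size _) (leqnn (size (msupp p))) => N.
elim: N p => [|N IH] p szp [pF pI].
  exists 0; rewrite mul0r; apply/eqP; rewrite -msupp_eq0.
  by rewrite -size_eq0 -leqn0.
have [p0|[a pa]] : p = 0 \/ exists a, a \in msupp p.
- have [->|] := eqVneq p 0; first by left.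
  by rewrite -msupp_eq0; case: (msupp p) => // a s _; right; exists a; rewrite mem_head.
- by exists 0; rewrite mul0r.
have [b [pb ba abE]] : exists b, [/\ b \in msupp p, b != a & vertex_exp b = vertex_exp a].
  have [/hasP[b pb /andP[ba /eqP ab]]|/hasPn none] :=
      boolP (has (fun b => (b != a) && (vertex_exp b == vertex_exp a)) (msupp p)).
    by exists b.
  (* Without such a [b], the image of [p] would have the nonzero coefficient [p@_a] at
     [vertex_exp a]. *)
  have := congr1 (mcoeff (vertex_exp a)) pI; rewrite mcoeff0.
  rewrite /toric_map comp_mpolyEX raddf_sum /= (bigD1_seq a) //= big1_seq.
    rewrite mcoeffZ -/(toric_map _ _) toric_mapX mcoeffX eqxx mulr1 addr0.
    by move/eqP; rewrite mcoeff_eq0 pa.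
  move=> b /andP[ba pb]; rewrite mcoeffZ -/(toric_map _ _) toric_mapX mcoeffX.
  by have := none b pb; rewrite ba /= => /negPf->; rewrite mulr0.
have aF := (msupport_subP F p pF) a pa; have bF := (msupport_subP F p pF) b pb.
pose p' := p - p@_a *: ('X_[a] - 'X_[b]).
have [] := IH p'.
(* [a] leaves the support and [b] was already in it, so [p'] has fewer terms. *)
- rewrite -ltnS (leq_trans _ szp) // (perm_size (perm_to_rem pa)) /= ltnS.
  apply: uniq_leq_size => // w wp'.
  rewrite mem_rem_uniq // !inE; apply/andP; split.
    apply: contraTneq wp' => ->; rewrite mcoeff_msupp negbK mcoeffB mcoeffZ mcoeffB.
    by rewrite !mcoeffX eqxx (negPf ba) subr0 mulr1 subrr.
  apply: contraTT wp'; rewrite !mcoeff_msupp !negbK mcoeffB mcoeffZ mcoeffB !mcoeffX.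
  move=> /eqP w0; rewrite w0 sub0r oppr_eq0.
  have /negPf-> : a != w by apply: contraTneq pa => ->; rewrite mcoeff_msupp w0 eqxx.
  have /negPf-> : b != w by apply: contraTneq pb => ->; rewrite mcoeff_msupp w0 eqxx.
  by rewrite subrr mulr0.
- split; last first.
    rewrite /toric_ideal toric_mapB pI toric_mapZ.
    by rewrite (toric_ideal_binomial a b).2 // scaler0 subrr.
  by apply/msupportB/msupportZ/msupportB => //; apply/msupportX.
move=> q' q'E.
have [q qE] := binomial_in_lattice span (relation_exp_diff (esym abE) aF bF).
exists (q' + p@_a *: q); rewrite mulrDl -q'E -scalerAl -qE.
by rewrite subrK.
Qed.

Lemma lattice_binomial_generates F z : z != 0 -> relation F z ->
    (forall y, relation F y -> exists k, y = k *: z) ->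
  generates D F (lattice_binomial z).
Proof.
move=> z0 zR span p; have [fF fI] := lattice_binomial_ideal zR; split=> [pI|[q [qF ->]]].
  have [q pE] := toric_ideal_sub_multiple span pI.
  have [q0|q0] := eqVneq q 0; first by exists 0; rewrite pE q0 !mul0r msupport0 sub0set.
  (* The cofactor stays in the variables of F, as the support of a product is the union of the
     supports. *)
  exists q; split=> //; apply: subset_trans (proj1 pI).
  by rewrite pE msupportM ?lattice_binomial_neq0 // subsetUl.
split; first exact: msupportM_sub.
by rewrite /toric_ideal toric_mapM fI mulr0.
Qed.

End ToricGenerator.

(** * Primitive generators, irreducibility and circuits *)

Section Circuits.
Variables (K : fieldType) (n m : nat) (D : wograph n m).
Implicit Types (p q f g : {mpoly K[m]}) (F : {set 'I_m}) (u v : 'X_{1..m}).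

Lemma generates_mem F f : generates D F f -> toric_ideal_sub D F f.
Proof.
move=> gen; apply/gen; exists 1; rewrite mul1r; split=> //.
by apply/msupport_subP => u; rewrite msupp1 mem_seq1 => /eqP-> i _; rewrite mnm0E.
Qed.

(** Comparing degrees makes [q] constant, and comparing coefficients leaves equality or an exchange
    of the two monomials. An exchange would make the monomials of [u] and [v] divide each other. *)
Lemma binomial_multiple_eq u v u' v' q : u != v -> u' != v' ->
    (u' <= u)%MM -> (v' <= v)%MM ->
    'X_[u'] - 'X_[v'] = q * ('X_[u] - 'X_[v]) ->
  'X_[u'] - 'X_[v'] = 'X_[u] - 'X_[v] :> {mpoly K[m]}.
Proof.
move=> uv uv' uu vv qE; set f := 'X_[u] - 'X_[v] in qE *.
have f0 : f != 0 by rewrite binomial_neq0.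
have q0 : q != 0.
  by apply: contraNneq uv' => q0; rewrite -(binomial_neq0 K) qE q0 mul0r.
have cE w : (q * f)@_w = (u' == w)%:R - (v' == w)%:R by rewrite -qE mcoeffB !mcoeffX.
have szq : (msize q <= 1)%N.
  have fu : (mdeg u < msize f)%N.
    apply: msize_mdeg_lt; rewrite mcoeff_msupp mcoeffB !mcoeffX eqxx.
    by rewrite [v == u]eq_sym (negPf uv) subr0 oner_eq0.
  have fv : (mdeg v < msize f)%N.
    apply: msize_mdeg_lt; rewrite mcoeff_msupp mcoeffB !mcoeffX eqxx.
    by rewrite (negPf uv) sub0r oppr_eq0 oner_eq0.
  have deg_le (w w' : 'X_{1..m}) : (w <= w')%MM -> (mdeg w <= mdeg w')%N.
    by move=> /mnm_lepP ww; rewrite !mdegE leq_sum.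
  have : (msize (q * f) <= msize f)%N.
    rewrite -qE msizeE; apply/bigmax_leqP_seq => w /msuppB_le.
    rewrite mem_cat !msuppX !mem_seq1 => /orP[]/eqP-> _.
      exact: leq_ltn_trans (deg_le _ _ uu) fu.
    exact: leq_ltn_trans (deg_le _ _ vv) fv.
  rewrite msizeM //; move: (mmeasure _ q) (mmeasure _ f) (mdeg u) fu => a b k; lia.
have [c qC] : exists c, q = c%:MP by exists q@_0; apply: msize1_polyC.
have c0 : c != 0 by apply: contraNneq q0 => c0; rewrite qC c0 mpolyC0.
have := cE u; have := cE v; rewrite !qC !mcoeffCM /f !mcoeffB !mcoeffX !eqxx.
rewrite [v == u]eq_sym (negPf uv) subr0 sub0r mulr1.
have [uu'|uu'] := eqVneq u' u.
  have -> : (v' == u) = false by rewrite -uu' eq_sym (negPf uv').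
  rewrite subr0 => _ c1.
  by rewrite qE qC c1 mpolyC1 mul1r.
have [vu'|vu'] := eqVneq v' u; last by move=> _ /eqP; rewrite subrr (negPf c0).
rewrite vu' (negPf uv) subr0 sub0r => cv c1; move: cv; rewrite c1 mulrN1 opprK.
have [vE|_ /eqP] := eqVneq u' v; last by rewrite oner_eq0.
case/eqP: uv; apply/mnmP => i; apply/eqP; rewrite eqn_leq.
by rewrite -{1}vu' (mnm_lepP vv) -{1}vE (mnm_lepP uu).
Qed.

Lemma binomial_generates_primitive F u v : u != v ->
    generates D F ('X_[K, u] - 'X_[v]) ->
  primitive (toric_ideal_sub D F) ('X_[K, u] - 'X_[v]).
Proof.
move=> uv gen; exists u, v; split=> //.
- by apply/eqP; rewrite binomial_neq0.
- exact: generates_mem.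
move=> u' v' /eqP uv' /gen[q [_ qE]] uu vv.
by apply: binomial_multiple_eq qE; rewrite // -(binomial_neq0 K).
Qed.

(** The choice in [toric_gen] is harmless: the lattice binomial of a basis vector of the kernel has
    the required property, so the chosen polynomial has it too. *)
Lemma toric_gen_spec F : kernel_line D F ->
  primitive (toric_ideal_sub D F) (toric_gen K D F) /\ generates D F (toric_gen K D F).
Proof.
move=> /kernel_line_basis[z [z0 zR span]].
apply: (epsilon_spec (inhabits 0)
  (fun f : {mpoly K[m]} => primitive (toric_ideal_sub D F) f /\ generates D F f)).
have gen := @lattice_binomial_generates K _ _ _ _ _ z0 zR span.
exists (lattice_binomial K z); split=> //; apply: binomial_generates_primitive => //.
by rewrite -(binomial_neq0 K) lattice_binomial_neq0.
Qed.

Lemma toric_ideal_nonunit p : toric_ideal D p -> p \isn't a GRing.unit.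
Proof.
move=> pI; apply/negP => /mulVr /(congr1 (@toric_map K n m D)).
rewrite toric_mapM pI mulr0 => /esym/eqP.
by rewrite /toric_map rmorph1 oner_eq0.
Qed.

(* [I_F] is the kernel of a morphism to an integral domain, hence prime. *)
Lemma generates_irreducible F f : f != 0 -> generates D F f -> irreducible_mpoly f.
Proof.
move=> f0 gen; have [fF fI] := generates_mem gen.
split; [exact/eqP | exact: toric_ideal_nonunit | move=> g h fE].
have [g0 h0] : g != 0 /\ h != 0.
  by apply/andP; rewrite -negb_or -mulf_eq0 -fE.
have factor_unit a b : f = a * b -> b != 0 -> toric_ideal D a ->
    msupport a \subset F -> b \is a GRing.unit.
  move=> abE b0 aI aF; have [q [_ qE]] := (gen a).1 (conj aF aI).
  apply/unitrPr; exists q; apply: (mulfI f0).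
  by rewrite mulr1 [RHS]abE qE mulrA [LHS]mulrC mulrA.
have ghF : msupport g :|: msupport h \subset F by rewrite -msupportM // -fE.
have /eqP : toric_map D g * toric_map D h = 0 by rewrite -toric_mapM -fE.
rewrite mulf_eq0 => /orP[] /eqP I0; [right | left].
  exact: factor_unit fE h0 I0 (subset_trans (subsetUl _ _) ghF).
apply: (@factor_unit h g) => //; first by rewrite mulrC.
exact: subset_trans (subsetUr _ _) ghF.
Qed.

(** A binomial of the toric ideal supported within the generator lies in I_F, hence is a multiple of
    the generator, and its support contains that of the generator. *)
Lemma toric_gen_circuit F : kernel_line D F -> circuit D (toric_gen K D F).
Proof.
move=> /toric_gen_spec; move: (toric_gen K D F) => f [prim gen].
have f0 : f != 0 by case: prim => u [v [_ /eqP]].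
have [fF fI] := generates_mem gen.
split=> //.
- by split; [exact/eqP | case: prim => u [v [fE _ _ _]]; exists u, v].
- exact: generates_irreducible f0 gen.
move=> g [/eqP g0 _] gI gf; apply/eqP; rewrite eqEsubset gf.
have [q [_ qE]] := (gen g).1 (conj (subset_trans gf fF) gI).
have q0 : q != 0 by apply: contraNneq g0 => q0; rewrite qE q0 mul0r.
by rewrite qE msupportM // subsetUr.
Qed.

Lemma circuit_opp f : circuit D f -> circuit D (- f).
Proof.
have suppN g : msupport (- g) = msupport g.
  by apply/setP => i; rewrite !inE (perm_has _ (msuppN g)).
case=> [[f0 [u [v fE]]] fI [_ fU firr] fmin]; split.
- split; first by move=> /eqP; rewrite oppr_eq0 => /eqP.
  by exists v, u; rewrite fE opprB.
- by rewrite /toric_ideal -[- f]sub0r toric_mapB fI subr0 /toric_map raddf0.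
- split; first by move=> /eqP; rewrite oppr_eq0 => /eqP.
    by rewrite unitrN.
  move=> g h ghE; have [] := firr (- g) h; first by rewrite mulNr -ghE opprK.
    by rewrite unitrN; left.
  by right.
by rewrite suppN.
Qed.

(** By minimality the generator uses all variables of [f], which puts [f] in I_F. So [f] is a
    multiple of the generator, and irreducibility makes the cofactor a constant. *)
Lemma circuit_toric_gen F f : kernel_line D F -> F \subset msupport f ->
  circuit D f -> eq_up_to_sign f (toric_gen K D F).
Proof.
move=> kl Ff [[f0 [u [v fE]]] fI [_ fU firr] fmin].
have [[gbin gI _ _] [_ gen]] := (toric_gen_circuit kl, toric_gen_spec kl).
move: (toric_gen K D F) gbin gI gen => g [/eqP g0 [u' [v' gE]]] gI gen.
have [gF _] := generates_mem gen.
have sgf : msupport g = msupport f.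
  apply: fmin => //; last exact: subset_trans gF Ff.
  by split; [exact/eqP | exists u', v'].
have fF : msupport f \subset F by rewrite -sgf.
have [q [_ qE]] := (gen f).1 (conj fF fI).
have qU : q \is a GRing.unit.
  by case: (firr q g qE) => // gU; have /negP := toric_ideal_nonunit gI.
have [c qC] : exists c, q = c%:MP by case/andP: qU => /eqP qC _; exists q@_0.
have uv : u' != v' by rewrite -(binomial_neq0 K) -gE.
have cE w : (u == w)%:R - (v == w)%:R = c * ((u' == w)%:R - (v' == w)%:R).
  by rewrite -!mcoeffX -!mcoeffB -gE -mcoeffCM -qC -qE fE.
(* At [u'] the right-hand side is [c] and the left-hand side is -1, 0 or 1; as [c] is nonzero, it is
   a sign. *)
have := cE u'; rewrite eqxx [v' == u']eq_sym (negPf uv) subr0 mulr1.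
have c0 : c != 0 by apply/eqP => c0; apply: f0; rewrite qE qC c0 mul0r.
rewrite /eq_up_to_sign qE qC mul_mpolyC.
case: eqP => _; case: eqP => _; rewrite ?subrr ?subr0 ?sub0r => cE'.
- by rewrite -cE' eqxx in c0.
- by left; rewrite -cE' scale1r.
- by right; rewrite -cE' scaleN1r.
- by rewrite -cE' eqxx in c0.
Qed.

End Circuits.

(** * Incidences of edges, cycles and paths *)

Section GraphBasics.
Variables (n m : nat) (D : wograph n m).
Implicit Types (e : 'I_m) (x y : 'I_n) (C : wcycle D) (P : wpath D).

Definition ends e : {set 'I_n} := [set src D e; tgt D e].

Lemma joins_ends e x y : joins D e x y -> ends e = [set x; y].
Proof. by []. Qed.

Lemma ends_inj : injective ends.
Proof. by move=> e e' /no_parallel. Qed.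

Lemma joins_cases e x y : joins D e x y ->
  src D e = x /\ tgt D e = y \/ src D e = y /\ tgt D e = x.
Proof.
move=> exy; have se : src D e \in ends e by rewrite set21.
have te : tgt D e \in ends e by rewrite set22.
move: se te (no_loop D e); rewrite (joins_ends exy) !inE.
by case/orP=> /eqP-> /orP[]/eqP->; rewrite ?eqxx //; auto.
Qed.

Lemma joins_neq e x y : joins D e x y -> x != y.
Proof.
by case/joins_cases=> -[<- <-]; rewrite ?no_loop // eq_sym no_loop.
Qed.

Lemma incidence_eq0 x e : (incidence D x e == 0) = (x \notin ends e).
Proof.
rewrite mxE !inE; case: (x == src D e); first by rewrite oner_eq0.
case: (x == tgt D e); last by rewrite eqxx.
by apply/negbTE/eqP; have := weight_gt0 D x; lia.
Qed.

(** Two positions carrying the same edge are equal or successors of each other, and the latter would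
    force the length to be at most two. *)
Lemma cedge_inj C : injective (@cedge n m D C).
Proof.
have no2 a k : (2 < k)%N -> (a < k)%N -> ((a.+1 %% k).+1 %% k)%N <> a.
  move=> k3 ak; have [Sa|aS] := ltnP a.+1 k; first rewrite (modn_small Sa).
    have [SSa|aSS] := ltnP a.+2 k; first by rewrite modn_small //; lia.
    have -> : a.+2 = k by lia.
    by rewrite modnn; lia.
  have -> : a.+1 = k by lia.
  by rewrite modnn modn_small; lia.
move=> i j ij; have := joins_ends (cedgeP i); rewrite ij (joins_ends (cedgeP j)).
move=> eqS.
have iS : cvtx i \in [set cvtx j; cvtx (ordS j)] by rewrite eqS set21.
have Si : cvtx (ordS i) \in [set cvtx j; cvtx (ordS j)] by rewrite eqS set22.
move: iS Si; rewrite !inE !(inj_eq (@cvtx_inj _ _ _ C)).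
case/orP=> [/eqP//|/eqP iSj]; case/orP=> /eqP Sij; last exact: ordS_inj Sij.
by case: (no2 _ _ (clen_gt2 C) (ltn_ord j)); have := congr1 val Sij; rewrite iSj.
Qed.

Lemma mem_cedge C i : @cedge n m D C i \in cycle_edges C.
Proof. exact: imset_f. Qed.

Lemma mem_cvtx C i : @cvtx n m D C i \in cycle_verts C.
Proof. exact: imset_f. Qed.

Lemma mem_pedge P i : @pedge n m D P i \in path_edges P.
Proof. exact: imset_f. Qed.

Lemma card_cycle_edges C : #|cycle_edges C| = clen C.
Proof. by rewrite card_imset ?card_ord //; apply: cedge_inj. Qed.

Lemma card_cycle_verts C : #|cycle_verts C| = clen C.
Proof. by rewrite card_imset ?card_ord //; apply: cvtx_inj. Qed.

Lemma ends_cycle C e : e \in cycle_edges C -> ends e \subset cycle_verts C.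
Proof.
case/imsetP=> i _ ->; rewrite (joins_ends (cedgeP i)); apply/subsetP => x.
by rewrite !inE => /orP[]/eqP->; apply: imset_f.
Qed.

Lemma pedge_inj P : injective (@pedge n m D P).
Proof.
move=> i j ij; have := joins_ends (pedgeP i); rewrite ij (joins_ends (pedgeP j)).
move=> eqS.
set ji := widen_ord _ j in eqS; set jS := lift ord0 j in eqS.
set ii := widen_ord _ i in eqS; set iS := lift ord0 i in eqS.
have hi : pvtx ii \in [set pvtx ji; pvtx jS] by rewrite eqS set21.
have hS : pvtx iS \in [set pvtx ji; pvtx jS] by rewrite eqS set22.
move: hi hS; rewrite !inE !(inj_eq (@pvtx_inj _ _ _ P)) -!val_eqE /= /bump /= !add1n.
by move=> hi hS; apply/val_inj => /=; move: hi hS; lia.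
Qed.

Lemma card_path_edges P : #|path_edges P| = plen P.
Proof. by rewrite card_imset ?card_ord //; apply: pedge_inj. Qed.

Lemma card_path_verts P : #|path_verts P| = (plen P).+1.
Proof. by rewrite card_imset ?card_ord //; apply: pvtx_inj. Qed.

Lemma ends_path P e : e \in path_edges P -> ends e \subset path_verts P.
Proof.
case/imsetP=> i _ ->; rewrite (joins_ends (pedgeP i)); apply/subsetP => x.
by rewrite !inE => /orP[]/eqP->; apply: imset_f.
Qed.

Lemma card_ends e : #|ends e| = 2.
Proof. by rewrite cards2 no_loop. Qed.

End GraphBasics.

(** * Rank-one kernels by counting vertices and edges *)

Section KernelLine.
Variables (n m : nat) (D : wograph n m).
Implicit Types (e : 'I_m) (x : 'I_n) (C : wcycle D) (P : wpath D).
Implicit Types (F : {set 'I_m}) (V : {set 'I_n}) (z : 'cV[int]_m).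

(** Multiplying by the product of all denominators makes [c] integral and keeps its pattern of
    zeros. *)
Lemma rat_relation F (c : 'cV[rat]_m) : (forall e, e \notin F -> c e 0 = 0) ->
    map_mx intr (incidence D) *m c = 0 ->
  exists2 z, relation D F z & forall e, (z e 0 == 0) = (c e 0 == 0).
Proof.
move=> cF Ac; pose d : int := \prod_e denq (c e 0).
have dn0 : (d%:~R : rat) != 0.
  by rewrite intr_eq0; apply/prodf_neq0 => e _; apply: denq_neq0.
pose z : 'cV[int]_m := \col_e (numq (c e 0) * \prod_(j | j != e) denq (c j 0)).
have zE : map_mx intr z = d%:~R *: c.
  apply/colP => e; rewrite !mxE /d [in RHS](bigD1 e) //= !intrM numqE.
  by rewrite -[LHS]mulrA [LHS]mulrC.
have zc e : (z e 0 == 0) = (c e 0 == 0).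
  have /colP/(_ e) := zE; rewrite mxE [RHS]mxE => ze.
  by rewrite -(intr_eq0 rat) ze mulf_eq0 (negPf dn0).
exists z => //; split; last by move=> e /cF ce; apply/eqP; rewrite zc ce.
have /matrixP Az : map_mx (intr : int -> rat) (incidence D *m z) = 0.
  by rewrite map_mxM zE -scalemxAr Ac scaler0.
apply/matrixP => i j; have /eqP := Az i j.
by rewrite [X in X == _]mxE [X in _ == X]mxE intr_eq0 => /eqP->; rewrite mxE.
Qed.

Lemma relation_sum F z : relation D F z ->
  forall x, \sum_e incidence D x e * z e 0 = 0.
Proof. by case=> Az _ x; have /colP/(_ x) := Az; rewrite mxE [X in _ = X]mxE. Qed.

(** The hypothesis on [y] says that the transposed incidence matrix is injective on functions on V.
    So the matrix has rank [#|V|], and its kernel on F has dimension [#|F|] - [#|V|] = 1. *)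
Lemma kernel_line_count F V : {in F, forall e, ends D e \subset V} ->
    #|F| = #|V|.+1 ->
    (forall y : 'I_n -> rat,
       {in F, forall e, y (src D e) + (weight D (tgt D e))%:R * y (tgt D e) = 0} ->
       {in V, forall x, y x = 0}) ->
  kernel_line D F.
Proof.
move=> FV cardF inj.
pose B : 'M[rat]_(#|F|, #|V|) :=
  \matrix_(i, j) (incidence D (enum_val j) (enum_val i))%:~R.
have rankB : \rank B = #|V|.
  rewrite -mxrank_tr; apply/eqP/inj_row_free => v vB.
  (* This extends [v] by zero to all vertices; [c] below extends [k] to all edges in the same
     way. *)
  pose y x := \sum_j v 0 j * (enum_val j == x)%:R.
  have yV j : y (enum_val j) = v 0 j.
    rewrite /y (bigD1 j) //= eqxx mulr1 big1 ?addr0 // => i ij.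
    by rewrite (inj_eq enum_val_inj) (negPf ij) mulr0.
  apply/rowP => j; rewrite mxE -yV; apply: inj (enum_valP j) => e eF.
  have /rowP/(_ (enum_rank_in eF e)) := vB; rewrite [RHS]mxE => <-.
  rewrite /y mxE mulr_sumr -big_split /=; apply: eq_bigr => k _.
  rewrite [_^T _ _]mxE [B _ _]mxE enum_rankK_in // incidenceE mulrCA -mulrDr rmorphD rmorphM /=.
  by rewrite -!pmulrn.
have rank_ker : \rank (kermx B) = 1%N by rewrite mxrank_ker rankB cardF subSnn.
pose k := nz_row (kermx B).
have k0 : k != 0 by rewrite nz_row_eq0 -mxrank_eq0 rank_ker.
have /sub_kermxP kB : (k <= kermx B)%MS := nz_row_sub _.
have span (v : 'rV_#|F|) : v *m B = 0 -> exists a, v = a *: k.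
  move=> /sub_kermxP vB; apply/sub_rVP; apply: submx_trans vB _.
  have [_] := mxrank_leqif_sup (nz_row_sub (kermx B)).
  by rewrite rank_ker rank_rV -/k k0 => /esym.
have AF x e : e \in F -> x \notin V -> incidence D x e = 0.
  move=> eF xV; apply/eqP; rewrite incidence_eq0; apply: contra xV.
  exact: (subsetP (FV e eF)).
pose c : 'cV[rat]_m := \col_e \sum_i k 0 i * (enum_val i == e)%:R.
have cE i : c (enum_val i) 0 = k 0 i.
  rewrite mxE (bigD1 i) //= eqxx mulr1 big1 ?addr0 // => j ij.
  by rewrite (inj_eq enum_val_inj) (negPf ij) mulr0.
have cF e : e \notin F -> c e 0 = 0.
  move=> eF; rewrite mxE big1 // => i _; case: eqP => [ie|]; last by rewrite mulr0.
  by rewrite -ie enum_valP in eF.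
have sumF (R : nmodType) (f : 'I_m -> R) : (forall e, e \notin F -> f e = 0) ->
    \sum_e f e = \sum_(i < #|F|) f (enum_val i).
  move=> fF; rewrite -big_enum_val /= [LHS](bigID (mem F)) /= [X in _ + X]big1 ?addr0 //.
have [z zR zc] : exists2 z, relation D F z & forall e, (z e 0 == 0) = (c e 0 == 0).
  apply: rat_relation => //; apply/colP => x; rewrite mxE [RHS]mxE sumF; last first.
    by move=> e eF; rewrite cF // mulr0.
  (* Vertices outside V meet no edge of F, so their equations are trivial; the others are the
     equations of [B]. *)
  have [xV|xV] := boolP (x \in V); last first.
    by rewrite big1 // => i _; rewrite [map_mx _ _ _ _]mxE AF ?enum_valP // mul0r.
  have /rowP/(_ (enum_rank_in xV x)) := kB; rewrite mxE [RHS]mxE => kx.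
  rewrite -[RHS]kx; apply: eq_bigr => i _.
  by rewrite [map_mx _ _ _ _]mxE [B _ _]mxE enum_rankK_in // cE mulrC.
have /rV0Pn[i ki] := k0.
exists z => //; exists (enum_val i); first by rewrite zc cE.
(* The restriction of [y] to F is a rational multiple of [k], and its vanishing at a place where [k]
   does not vanish makes the factor zero. *)
move=> y [yR yF] yi; pose v : 'rV[rat]_#|F| := \row_j (y (enum_val j) 0)%:~R.
have [|a va] := span v.
  apply/rowP => j; have := relation_sum (conj yR yF) (enum_val j).
  rewrite sumF; last by move=> e eF; rewrite yF // mulr0.
  move=> sum0; rewrite mxE [RHS]mxE -[RHS](mulr0z 1) -[in RHS]sum0.
  rewrite [RHS]rmorph_sum /=.
  by apply: eq_bigr => l _; rewrite [v _ _]mxE [B _ _]mxE intrM mulrC.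
have a0 : a = 0.
  have /rowP/(_ i) := va; rewrite !mxE yi => /esym/eqP.
  by rewrite mulf_eq0 (negPf ki) orbF => /eqP.
apply/colP => e; rewrite mxE; have [eF|eF] := boolP (e \in F); last exact: yF.
have /rowP/(_ (enum_rank_in eF e)) := va.
rewrite a0 scale0r !mxE enum_rankK_in // => /eqP.
by rewrite intr_eq0 => /eqP.
Qed.

End KernelLine.

(** * Kernels of balanced and of unbalanced cycles *)

Section Configurations.
Variables (n m : nat) (D : wograph n m).
Implicit Types (e : 'I_m) (x : 'I_n) (C : wcycle D) (P : wpath D).

(** The entry at [e] of the row vector y A(D). *)
Definition edge_functional (y : 'I_n -> rat) e : rat :=
  y (src D e) + (weight D (tgt D e))%:R * y (tgt D e).

(** Both entries in the column of [e], namely 1 and a weight, are nonzero, so the value at one end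
    determines the other. *)
Lemma edge_functional_step y e a b : edge_functional y e = 0 -> joins D e a b ->
  y a = 0 -> y b = 0.
Proof.
rewrite /edge_functional => ye /joins_cases[] [ea eb] ya; move: ye.
  rewrite ea ya add0r eb => /eqP; rewrite mulf_eq0 pnatr_eq0.
  by rewrite -leqn0 leqNgt weight_gt0 /= => /eqP.
by rewrite eb ya mulr0 addr0 ea.
Qed.

(** An edge of the cycle has both ends on it, so the values of [y] on the cycle form a row vector
    killed by A(C), which is invertible over the rationals. *)
Lemma unbalanced_functional C (y : 'I_n -> rat) : unbalanced C ->
    {in cycle_edges C, forall e, edge_functional y e = 0} ->
  {in cycle_verts C, forall x, y x = 0}.
Proof.
move=> unb ye x /imsetP[i _ ->] {x}.
pose M : 'M[rat]_(clen C) := map_mx intr (cycle_incidence C).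
have MU : M \in unitmx.
  by rewrite unitmxE det_map_mx unitfE intr_eq0; apply/eqP.
pose v := \row_j y (@cvtx _ _ _ C j).
suff v0 : v = 0 by have /rowP/(_ i) := v0; rewrite !mxE.
rewrite -[v](mulmxK MU); suff -> : v *m M = 0 by rewrite mul0mx.
apply/rowP => j; rewrite mxE [RHS]mxE -[RHS](ye (cedge j)) ?mem_cedge //.
have vert a : a \in ends D (@cedge _ _ _ C j) -> exists k, @cvtx _ _ _ C k = a.
  by move/(subsetP (ends_cycle (mem_cedge j))) => /imsetP[k _ ->]; exists k.
have [[s sE] [t tE]] := (vert _ (set21 _ _), vert _ (set22 _ _)).
rewrite (eq_bigr (fun k => y (cvtx k) * (k == s)%:R +
    (weight D (tgt D (cedge j)))%:R * (y (cvtx k) * (k == t)%:R))); last first.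
  move=> k _; rewrite [v _ _]mxE [M _ _]mxE [cycle_incidence _ _ _]mxE incidenceE.
  rewrite -sE -tE !(inj_eq (@cvtx_inj _ _ _ C)) rmorphD rmorphM /= -!pmulrn.
  by rewrite mulrDr mulrCA.
have delta l : \sum_k y (cvtx k) * (k == l)%:R = y (@cvtx _ _ _ C l).
  rewrite (bigD1 l) //= eqxx mulr1 big1 ?addr0 // => k /negPf->.
  by rewrite mulr0.
by rewrite big_split -mulr_sumr !delta /edge_functional sE tE.
Qed.

Lemma incident_cycle_edge C i e : e \in cycle_edges C -> cvtx (ordS i) \in ends D e ->
  e = @cedge _ _ _ C i \/ e = cedge (ordS i).
Proof.
case/imsetP=> j _ ->; rewrite (joins_ends (cedgeP j)) !inE.
by rewrite !(inj_eq (@cvtx_inj _ _ _ C)) => /orP[/eqP->|/eqP/ordS_inj->]; auto.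
Qed.

(** At the vertex between two consecutive edges of C no other edge of C occurs, and both entries are
    nonzero; so a zero coordinate propagates around C. *)
Lemma cycle_relation0 C (y : 'cV[int]_m) : relation D (cycle_edges C) y ->
  forall i, y (@cedge _ _ _ C i) 0 = 0 -> y = 0.
Proof.
move=> yR i0 y0.
have step i : y (@cedge _ _ _ C i) 0 = 0 -> y (cedge (ordS i)) 0 = 0.
  move=> yi; have := relation_sum yR (cvtx (ordS i)).
  rewrite (bigD1 (cedge (ordS i))) //= big1 ?addr0 => [|e eS].
    move/eqP; rewrite mulf_eq0 incidence_eq0.
    by rewrite (joins_ends (cedgeP _)) set21 => /eqP.
  have [eC|eC] := boolP (e \in cycle_edges C); last by rewrite yR.2 // mulr0.
  have [eV|eV] := boolP (cvtx (ordS i) \in ends D e).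
    have [->|eE] := incident_cycle_edge eC eV; first by rewrite yi mulr0.
    by rewrite eE eqxx in eS.
  by move: eV; rewrite -incidence_eq0 => /eqP->; rewrite mul0r.
have all k : y (cedge (iter k (@ordS _) i0)) 0 = 0 by elim: k => //= k; apply: step.
have reach k : nat_of_ord (iter k (@ordS _) i0) = ((i0 + k) %% clen C)%N.
  elim: k => [|k IH]; first by rewrite addn0 modn_small.
  by rewrite iterS /= IH -[X in (X %% _)%N = _]addn1 modnDml -addnA addn1.
apply/colP => e; rewrite mxE; have [/imsetP[j _ ->]|] := boolP (e \in cycle_edges C).
  (* This many steps lead from [i0] to [j]; the added full turn avoids a negative difference. *)
  rewrite -[RHS](all (j + (clen C - i0))%N); congr (y (cedge _) 0).
  apply/val_inj; rewrite /= reach addnCA subnKC ?modnDr ?modn_small //.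
  exact: ltnW.
by move=> eC; rewrite yR.2.
Qed.

(** A singular A(C) has a nonzero rational kernel vector. Extended by zero and made integral it is a
    relation, and a relation on a cycle is determined by any one coordinate. *)
Lemma kernel_line_balanced C : balanced C -> kernel_line D (cycle_edges C).
Proof.
move=> bal; pose M : 'M[rat]_(clen C) := map_mx intr (cycle_incidence C).
have /eqP : \det M^T = 0 by rewrite det_tr det_map_mx bal.
case/det0P=> k k0 kM; pose c : 'cV[rat]_m := \col_e \sum_i k 0 i * (cedge i == e)%:R.
have cE i : c (cedge i) 0 = k 0 i.
  rewrite mxE (bigD1 i) //= eqxx mulr1 big1 ?addr0 // => j ij.
  by rewrite (inj_eq (@cedge_inj _ _ _ C)) (negPf ij) mulr0.
have cF e : e \notin cycle_edges C -> c e 0 = 0.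
  move=> eF; rewrite mxE big1 // => i _; case: eqP => [ie|]; last by rewrite mulr0.
  by rewrite -ie mem_cedge in eF.
have [z zR zc] : exists2 z, relation D (cycle_edges C) z &
    forall e, (z e 0 == 0) = (c e 0 == 0).
  apply: rat_relation => //; apply/colP => x; rewrite mxE [RHS]mxE.
  rewrite (bigID (mem (cycle_edges C))) /= [X in _ + X]big1 ?addr0; last first.
    by move=> e eF; rewrite cF // mulr0.
  rewrite big_imset /=; last by move=> i j _ _; apply: cedge_inj.
  have [/imsetP[j _ ->]|xC] := boolP (x \in cycle_verts C).
    have /rowP/(_ j) := kM; rewrite mxE [X in _ = X]mxE => kj.
    rewrite -[RHS]kj.
    apply: eq_big => [i|i _]; first by rewrite inE.
    by rewrite cE [map_mx _ _ _ _]mxE [M^T _ _]mxE [M _ _]mxE [cycle_incidence _ _ _]mxE mulrC.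
  rewrite big1 // => i _; rewrite [map_mx _ _ _ _]mxE.
  suff /eqP-> : incidence D x (cedge i) == 0 by rewrite mul0r.
  rewrite incidence_eq0; apply: contra xC.
  by apply: subsetP; apply: ends_cycle; apply: mem_cedge.
have /rV0Pn[i ki] := k0.
exists z => //; exists (cedge i); first by rewrite zc cE.
by move=> y yR; apply: cycle_relation0 yR i.
Qed.

End Configurations.

(** * Kernels of pairs of unbalanced cycles *)

Section UnbalancedPairs.
Variables (n m : nat) (D : wograph n m).
Implicit Types (e : 'I_m) (x : 'I_n) (C : wcycle D) (P : wpath D).

(** Each cycle has as many edges as vertices, so by inclusion-exclusion an intersection with one
    vertex more than edges means a union with one edge more than vertices. *)
Lemma kernel_line_two_cycles C1 C2 : unbalanced C1 -> unbalanced C2 ->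
    #|cycle_verts C1 :&: cycle_verts C2| = #|cycle_edges C1 :&: cycle_edges C2|.+1 ->
  kernel_line D (cycle_edges C1 :|: cycle_edges C2).
Proof.
move=> u1 u2 cardI; apply: (@kernel_line_count _ _ _ _ (cycle_verts C1 :|: cycle_verts C2)).
- move=> e /setUP[] /ends_cycle eV; apply: subset_trans eV _.
    exact: subsetUl.
  exact: subsetUr.
- have := cardsUI (cycle_verts C1) (cycle_verts C2).
  have := cardsUI (cycle_edges C1) (cycle_edges C2).
  by rewrite !card_cycle_edges !card_cycle_verts cardI; lia.
move=> y yE x /setUP[xC|xC].
  by apply: unbalanced_functional u1 _ x xC => e eC; apply: yE; rewrite in_setU eC.
by apply: unbalanced_functional u2 _ x xC => e eC; apply: yE; rewrite in_setU eC orbT.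
Qed.

Lemma kernel_line_share_vertex C1 C2 : unbalanced C1 -> unbalanced C2 ->
  share_vertex C1 C2 -> kernel_line D (cycle_edges C1 :|: cycle_edges C2).
Proof.
move=> u1 u2 [x sV]; apply: kernel_line_two_cycles => //.
(* A common edge would have its two ends at the single common vertex. *)
rewrite sV cards1; congr _.+1; apply/esym/eqP; rewrite cards_eq0.
apply/eqP/setP => e; rewrite inE in_set0; apply/negP => /andP[/ends_cycle e1 /ends_cycle e2].
have : ends D e \subset [set x] by rewrite -sV subsetI e1.
by move/subset_leq_card; rewrite cards1 card_ends.
Qed.

Lemma kernel_line_share_path C1 C2 P : unbalanced C1 -> unbalanced C2 ->
  share_path C1 C2 P -> kernel_line D (cycle_edges C1 :|: cycle_edges C2).
Proof.
move=> u1 u2 [_ sV sE]; apply: kernel_line_two_cycles => //.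
by rewrite sV sE card_path_edges card_path_verts.
Qed.

Lemma path_functional P (y : 'I_n -> rat) :
    {in path_edges P, forall e, edge_functional D y e = 0} ->
  y (@pvtx _ _ _ P ord0) = 0 -> {in path_verts P, forall x, y x = 0}.
Proof.
move=> yE y0 x /imsetP[[k kP] _ ->] {x}.
elim: k kP => [|k IH] kP; first by rewrite -y0; congr (y (pvtx _)); apply: val_inj.
pose i := Ordinal (kP : k < plen P)%N.
have -> : Ordinal kP = lift ord0 i by apply: val_inj.
apply: edge_functional_step (yE _ (mem_pedge i)) (pedgeP i) _.
by rewrite -(IH (ltnW kP)); congr (y (pvtx _)); apply: val_inj.
Qed.

(** Cycles of lengths k1 and k2 and a path of length l have k1 + l + k2 edges and k1 + k2 + (l + 1)
    - 2 vertices. A function killed by all these edges vanishes on the cycles, and then along the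
    path from its first vertex. *)
Lemma kernel_line_connected C1 C2 P : unbalanced C1 -> unbalanced C2 ->
    connected_by C1 C2 P ->
  kernel_line D (cycle_edges C1 :|: path_edges P :|: cycle_edges C2).
Proof.
move=> u1 u2 [P0 dV p1 p2 PV].
set p := pvtx ord0 in p1 PV; set q := pvtx ord_max in p2 PV.
have pC2 : p \notin cycle_verts C2 by rewrite (disjointFr dV p1).
have qC1 : q \notin cycle_verts C1 by rewrite (disjointFl dV p2).
have pq : p != q by apply: contraNneq qC1 => <-.
(* The three edge sets are pairwise disjoint, since the vertex sets meet pairwise in at most one
   vertex and an edge has two ends. *)
have dE1 : [disjoint cycle_edges C1 & path_edges P].
  rewrite -setI_eq0; apply/eqP/setP => e; rewrite inE in_set0.
  apply/negP => /andP[/ends_cycle e1 /ends_path e2].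
  have /subset_leq_card : ends D e \subset [set p].
    apply/subsetP => x xe; have x1 := subsetP e1 x xe.
    have : x \in [set p; q] by rewrite -PV !inE (subsetP e2 x xe) x1.
    by rewrite !inE => /orP[//|/eqP xq]; rewrite -xq x1 in qC1.
  by rewrite cards1 card_ends.
have dE2 : [disjoint path_edges P & cycle_edges C2].
  rewrite -setI_eq0; apply/eqP/setP => e; rewrite inE in_set0.
  apply/negP => /andP[/ends_path e2 /ends_cycle e1].
  have /subset_leq_card : ends D e \subset [set q].
    apply/subsetP => x xe; have x1 := subsetP e1 x xe.
    have : x \in [set p; q] by rewrite -PV !inE (subsetP e2 x xe) x1 orbT.
    by rewrite !inE => /orP[/eqP xp|//]; rewrite -xp x1 in pC2.
  by rewrite cards1 card_ends.
have dE : [disjoint cycle_edges C1 & cycle_edges C2].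
  rewrite -setI_eq0; apply/eqP/setP => e; rewrite inE in_set0.
  apply/negP => /andP[/ends_cycle e1 /ends_cycle e2].
  have : ends D e \subset cycle_verts C1 :&: cycle_verts C2 by rewrite subsetI e1.
  move: dV; rewrite -setI_eq0 => /eqP->; rewrite subset0 -cards_eq0.
  by rewrite card_ends.
apply: (@kernel_line_count _ _ _ _ (path_verts P :|: (cycle_verts C1 :|: cycle_verts C2))).
- move=> e; rewrite !in_setU -orbA => /or3P[/ends_cycle|/ends_path|/ends_cycle] eV;
    apply: subset_trans eV _.
  + by rewrite setUCA subsetUl.
  + exact: subsetUl.
  + by rewrite setUA subsetUr.
- have cU (T : finType) (A B : {set T}) : [disjoint A & B] -> #|A :|: B| = (#|A| + #|B|)%N.
    by move=> AB; rewrite cardsU disjoint_setI0 // cards0 subn0.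
  have dE12 : [disjoint cycle_edges C1 :|: path_edges P & cycle_edges C2].
    by rewrite -setI_eq0 setIUl !disjoint_setI0 // setU0.
  have := cardsUI (path_verts P) (cycle_verts C1 :|: cycle_verts C2).
  rewrite PV cards2 pq card_path_verts (cU _ _ _ dE12) (cU _ _ _ dE1) (cU _ _ _ dV).
  by rewrite !card_cycle_edges !card_cycle_verts card_path_edges; lia.
move=> y yE.
have y1 : {in cycle_verts C1, forall x, y x = 0}.
  by apply: unbalanced_functional u1 _ => e eC; apply: yE; rewrite !in_setU eC.
have y2 : {in cycle_verts C2, forall x, y x = 0}.
  by apply: unbalanced_functional u2 _ => e eC; apply: yE; rewrite !in_setU eC orbT.
have yP : {in path_verts P, forall x, y x = 0}.
  apply: path_functional; last exact: y1 p1.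
  by move=> e eC; apply: yE; rewrite !in_setU eC orbT.
by move=> x; rewrite !in_setU => /or3P[/yP|/y1|/y2].
Qed.

End UnbalancedPairs.

(** * Vertex sequences as cycles and paths *)

Section Walks.
Variables (n m : nat) (D : wograph n m) (S : {set 'I_m}).
Implicit Types (e : 'I_m) (x y c t v : 'I_n) (s r : seq 'I_n).

Definition adj x y : bool := [exists e in S, ends D e == [set x; y]].

Lemma adjP x y : reflect (exists2 e, e \in S & ends D e = [set x; y]) (adj x y).
Proof.
apply: (iffP exists_inP) => -[e eS]; first by move/eqP; exists e.
by move=> eE; exists e => //; apply/eqP.
Qed.

Lemma adj_neq x y : adj x y -> x != y.
Proof. by case/adjP=> e _ /joins_neq. Qed.

Lemma adj_ends e x : e \in S -> x \in ends D e ->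
  exists y, adj x y /\ ends D e = [set x; y].
Proof.
move=> eS; rewrite !inE => /orP[]/eqP->; [exists (tgt D e) | exists (src D e)].
  by split=> //; apply/adjP; exists e.
by split; [apply/adjP; exists e => // |]; rewrite /ends setUC.
Qed.

(** Without parallel edges a step is determined by its two ends, so walks are recorded by their
    vertices alone. *)
Fixpoint walk_edges x s : {set 'I_m} :=
  if s is y :: s' then [set e | ends D e == [set x; y]] :|: walk_edges y s' else set0.

Lemma walk_edges_cat x s r :
  walk_edges x (s ++ r) = walk_edges x s :|: walk_edges (last x s) r.
Proof. by elim: s x => [|y s IH] x /=; rewrite ?set0U // IH setUA. Qed.

Lemma walk_edgesP z x s e :
  reflect (exists2 i, (i < size s)%N & ends D e = [set nth z (x :: s) i; nth z s i])
          (e \in walk_edges x s).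
Proof.
elim: s x => [|y s IH] x /=; first by rewrite inE; constructor => -[].
rewrite !inE; apply: (iffP orP) => [[/eqP eE | /(IH y)[i ii eE]] | [[|i] /= ii eE]].
- by exists 0%N.
- by exists i.+1.
- by left; apply/eqP.
- by right; apply/(IH y); exists i.
Qed.

Lemma walk_edges_sub x s : path adj x s -> walk_edges x s \subset S.
Proof.
elim: s x => [|y s IH] x /=; first by rewrite sub0set.
case/andP=> /adjP[e eS eE] /IH sS; rewrite subUset sS andbT.
apply/subsetP => e'; rewrite inE => /eqP e'E.
by rewrite (_ : e' = e) //; apply: (@ends_inj _ _ D); rewrite eE.
Qed.

(** Serves to show that an ear with inner vertices shares no edge with a cycle that these vertices
    avoid. *)
Lemma walk_edges_inner x r t e : r != [::] -> e \in walk_edges x (rcons r t) ->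
  exists2 v, v \in r & v \in ends D e.
Proof.
elim: r x => // v r IH x _ /=; rewrite inE => /orP[].
  by rewrite inE => /eqP->; exists v; rewrite ?mem_head // set22.
have [-> /=|r0 /(IH _ r0)[w wr we]] := eqVneq r [::]; last first.
  by exists w; rewrite // inE wr orbT.
by rewrite setU0 inE => /eqP->; exists v; rewrite ?mem_head // set21.
Qed.

(** Through [next], the edge set of a closed walk is seen not to depend on its starting vertex. *)
Lemma walk_edges_next x s e : uniq (x :: s) ->
  reflect (exists2 v, v \in x :: s & ends D e = [set v; next (x :: s) v])
          (e \in walk_edges x (rcons s x)).
Proof.
move=> us; apply: (iffP (walk_edgesP x _ _ _)); rewrite size_rcons.
- case=> i ii eE; exists (nth x (x :: s) i); first exact: mem_nth.
  rewrite next_nth mem_nth // index_uniq // eE -rcons_cons !nth_rcons_default.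
  by [].
- case=> v vs; rewrite next_nth vs => eE; exists (index v (x :: s)).
    by move: vs; rewrite -index_mem.
  by rewrite -rcons_cons !nth_rcons_default nth_index.
Qed.

Lemma seq_wcycle x s : uniq (x :: s) -> (1 < size s)%N -> path adj x (rcons s x) ->
  exists C : wcycle D,
    [/\ cycle_verts C = [set v in x :: s], cycle_edges C = walk_edges x (rcons s x)
      & cycle_edges C \subset S].
Proof.
move=> us ss ps; pose k := (size s).+1; pose f (i : 'I_k) := nth x (x :: s) i.
have fS i : f (ordS i) = nth x (rcons s x) i.
  (* At index [size s], one past the last entry of [s], the default [x] of [nth] supplies the first
     vertex and closes the cycle. *)
  rewrite /f /= nth_rcons_default; have := ltn_ord i; rewrite /k ltnS leq_eqVlt.
  case/orP=> [/eqP->|si]; first by rewrite modnn [RHS]nth_default.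
  by rewrite modn_small.
have /fin_all_exists[g gE] (i : 'I_k) : exists e, joins D e (f i) (f (ordS i)).
  have /(pathP x)/(_ i) := ps; rewrite size_rcons => /(_ (ltn_ord i)) /adjP[e _ eE].
  by exists e; rewrite /joins -/(ends D e) eE fS -rcons_cons !nth_rcons_default.
have finj : injective f.
  by move=> i j /eqP; rewrite nth_uniq ?ltn_ord // => /eqP/val_inj.
have edges : [set g i | i : 'I_k] = walk_edges x (rcons s x).
  apply/setP => e; apply/imsetP/(walk_edgesP x) => [[i _ ->]|[i]].
    exists i; first by rewrite size_rcons.
    by rewrite (joins_ends (gE i)) fS -rcons_cons !nth_rcons_default.
  rewrite size_rcons => ik eE; exists (Ordinal ik) => //; apply: (@ends_inj _ _ D).
  by rewrite eE (joins_ends (gE _)) fS -rcons_cons !nth_rcons_default.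
exists (@WCycle _ _ D k f g ss finj gE); split.
- apply/setP => v; rewrite inE; apply/imsetP/idP => [[i _ ->]|vs].
    exact: mem_nth.
  have ik : (index v (x :: s) < k)%N by rewrite index_mem.
  by exists (Ordinal ik) => //=; rewrite /f nth_index.
- exact: edges.
by rewrite [cycle_edges _]edges walk_edges_sub.
Qed.

Lemma seq_wpath x s : uniq (x :: s) -> path adj x s ->
  exists P : wpath D,
    [/\ plen P = size s, @pvtx _ _ _ P ord0 = x /\ @pvtx _ _ _ P ord_max = last x s,
        path_verts P = [set v in x :: s], path_edges P = walk_edges x s
      & path_edges P \subset S].
Proof.
move=> us ps; pose k := size s; pose f (i : 'I_k.+1) := nth x (x :: s) i.
have fw i : f (widen_ord (leqnSn k) i) = nth x (x :: s) i by [].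
have fl (i : 'I_k) : f (lift ord0 i) = nth x s i by rewrite /f lift0.
have /fin_all_exists[g gE] (i : 'I_k) :
    exists e, joins D e (f (widen_ord (leqnSn k) i)) (f (lift ord0 i)).
  have /(pathP x)/(_ i (ltn_ord i))/adjP[e _ eE] := ps.
  by exists e; rewrite /joins -/(ends D e) eE fl.
have finj : injective f.
  by move=> i j /eqP; rewrite nth_uniq ?ltn_ord // => /eqP/val_inj.
have edges : [set g i | i : 'I_k] = walk_edges x s.
  apply/setP => e; apply/imsetP/(walk_edgesP x) => [[i _ ->]|[i ik eE]].
    by exists i; rewrite ?(joins_ends (gE i)) ?fl.
  exists (Ordinal ik) => //; apply: (@ends_inj _ _ D).
  by rewrite eE (joins_ends (gE _)) fl.
exists (@WPath _ _ D k f g finj gE); split=> //.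
- by split=> //; rewrite /f /= (last_nth x).
- apply/setP => v; rewrite inE; apply/imsetP/idP => [[i _ ->]|vs].
    exact: mem_nth.
  have ik : (index v (x :: s) < k.+1)%N by rewrite index_mem.
  by exists (Ordinal ik) => //=; rewrite /f nth_index.
by rewrite [path_edges _]edges walk_edges_sub.
Qed.

End Walks.

(** * Search for a configuration in an edge set of minimum degree two *)

Section CircuitSubgraphs.
Variables (n m : nat) (D : wograph n m).
Implicit Types (e : 'I_m) (x y c t v : 'I_n) (s r : seq 'I_n) (F S : {set 'I_m}).

Definition circuit_shape F : Prop :=
  [\/ exists C : wcycle D, balanced C /\ F = cycle_edges C,
      exists C1 C2 : wcycle D, [/\ unbalanced C1, unbalanced C2, share_vertex C1 C2 &
        F = cycle_edges C1 :|: cycle_edges C2],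
      exists (C1 C2 : wcycle D) (P : wpath D),
        [/\ unbalanced C1, unbalanced C2, share_path C1 C2 P &
          F = cycle_edges C1 :|: cycle_edges C2] |
      exists (C1 C2 : wcycle D) (P : wpath D),
        [/\ unbalanced C1, unbalanced C2, connected_by C1 C2 P &
          F = cycle_edges C1 :|: path_edges P :|: cycle_edges C2]].

Lemma circuit_shape_kernel_line F : circuit_shape F -> kernel_line D F.
Proof.
case=> [[C [bC ->]]|[C1 [C2 [u1 u2 sh ->]]]|[C1 [C2 [P [u1 u2 sh ->]]]]|
        [C1 [C2 [P [u1 u2 sh ->]]]]].
- exact: kernel_line_balanced.
- exact: kernel_line_share_vertex.
- exact: kernel_line_share_path sh.
- exact: kernel_line_connected.
Qed.

Section Search.
Variable S : {set 'I_m}.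
Hypothesis min_degree2 : forall e x, e \in S -> x \in ends D e ->
  exists e', [/\ e' \in S, e' != e & x \in ends D e'].
Local Notation adj := (adj D S).

(** A second edge at [y] cannot lead back to [x], as it would be parallel to the first; so a walk
    can always go on without turning back. *)
Lemma adj_step x y : adj x y -> exists2 t, t != x & adj y t.
Proof.
case/adjP=> e eS eE; have [|e' [e'S e'e ye']] := min_degree2 (x := y) eS.
  by rewrite eE set22.
have [t [yt e'E]] := adj_ends e'S ye'; exists t => //.
apply: contraNneq e'e => tx; apply/eqP/(@ends_inj _ _ D).
by rewrite eE e'E tx setUC.
Qed.

(* Obtained by prolonging the walk c, y until it cannot avoid W and itself. *)
Lemma maximal_walk (W : {set 'I_n}) c y : adj c y -> y \notin W ->
  exists r l t, [/\ path adj c (rcons r l), uniq (rcons r l),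
    {in rcons r l, forall v, v \notin W}, adj l t /\ t != last c r &
    t \in W \/ t \in rcons r l].
Proof.
move=> cy yW; pose good r l :=
  [/\ path adj c (rcons r l), uniq (rcons r l) & {in rcons r l, forall v, v \notin W}].
have : good [::] y by split; rewrite /= ?cy // => v; rewrite inE => /eqP->.
move: [::] y {cy yW} => r l; move: {2}(n - size r)%N (leqnn (n - size r)) => N.
elim: N r l => [|N IH] r l szr [pr ur rW].
  exfalso.
  have := max_card (mem (rcons r l)); rewrite (card_uniqP ur) size_rcons card_ord.
  by move: szr; rewrite leqn0 subn_eq0 => /leq_ltn_trans h /h; rewrite ltnn.
have := pr; rewrite rcons_path => /andP[_ /adj_step[t tl lt]].
have [tW|tW] := boolP (t \in W); first by exists r, l, t; split=> //; left.
have [tr|tr] := boolP (t \in rcons r l); first by exists r, l, t; split=> //; right.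
apply: (IH (rcons r l) t); first by rewrite size_rcons; move: szr; lia.
split; first by rewrite rcons_path pr last_rcons.
  by rewrite rcons_uniq tr.
by move=> v; rewrite mem_rcons inE => /orP[/eqP->|/rW].
Qed.

(** The walk ends at another vertex of W, back at [c], or on itself. As its last step does not turn
    back, the closed walks of the last two cases have at least three vertices. *)
Lemma ear (W : {set 'I_n}) c y : c \in W -> adj c y -> y \notin W ->
  exists r t, [/\ path adj c (rcons r t), uniq r, {in r, forall v, v \notin W} &
    [\/ [/\ t \in W, t != c & r != [::]], t = c /\ (1 < size r)%N |
        exists r1 r2, r = r1 ++ t :: r2 /\ (1 < size r2)%N]].
Proof.
move=> cW cy yW; have [q [l [t [pq uq qW [lt tq] tWq]]]] := maximal_walk cy yW.
exists (rcons q l), t; split=> //; first by rewrite rcons_path pq last_rcons.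
case: tWq => [tW|]; last first.
  rewrite mem_rcons inE; have /negPf-> /= : t != l by rewrite eq_sym (adj_neq lt).
  move=> tinq; constructor 3; case/splitPr: tinq tq {uq qW pq} => q1 q2 tq.
  (* If [q2] were empty, [t] would be the vertex just before [l], which the last step avoids. *)
  exists q1, (rcons q2 l); rewrite rcons_cat /= size_rcons; split=> //.
  by case: q2 tq => //; rewrite last_cat /= eqxx.
have [tc|tc] := eqVneq t c; last by constructor 1; split=> //; case: (q).
constructor 2; split=> //; rewrite size_rcons ltnS lt0n size_eq0.
by apply: contraNneq tq => ->; rewrite tc.
Qed.

(** Taking W to consist of [c] alone leaves only the cases in which the walk closes up. *)
Lemma cycle_exists c y : adj c y -> exists x s,
  [/\ uniq (x :: s), (1 < size s)%N & path adj x (rcons s x)].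
Proof.
move=> cy; have [|r [t [pr ur rW]]] := ear (set11 c) cy.
  by rewrite inE eq_sym (adj_neq cy).
have cr : c \notin r by apply/negP => /rW; rewrite set11.
case=> [[]|[tc r2]|[r1 [r2 [rE r2_gt1]]]].
- by rewrite inE => ->.
- by exists c, r; rewrite /= cr; split=> //; rewrite -[X in rcons _ X]tc.
exists t, r2; move: ur pr; rewrite rE cat_uniq rcons_cat cat_path => /and3P[_ _ ur].
by case/andP=> _ /= /andP[_].
Qed.

Hypothesis no_balanced : forall C : wcycle D, cycle_edges C \subset S -> unbalanced C.

(** The ear from [c] to [t] replaces the arc through [a]; the new cycle and the old one then share
    exactly the arc from [t] through [b] back to [c]. *)
Lemma theta_shape c a t b r :
    uniq (c :: a ++ t :: b) -> (1 < size (a ++ t :: b))%N ->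
    path adj c (rcons (a ++ t :: b) c) -> path adj c (rcons r t) -> uniq r ->
    {in r, forall v, v \notin c :: a ++ t :: b} ->
    walk_edges D c (rcons (a ++ t :: b) c) :&: walk_edges D c (rcons r t) = set0 ->
  exists2 F, circuit_shape F & F \subset S.
Proof.
move=> us ss ps pr ur rW disjE.
have catE q : rcons (q ++ t :: b) c = rcons q t ++ rcons b c by rewrite rcons_cat -cat_rcons.
have [C1 [V1 E1 S1]] := seq_wcycle us ss ps.
have pb : path adj t (rcons b c).
  by move: ps; rewrite catE cat_path last_rcons => /andP[].
have us2 : uniq (c :: r ++ t :: b).
  move: us; rewrite !cons_uniq !cat_uniq !mem_cat negb_or => /andP[/andP[_ ctb] /and3P[_ _ utb]].
  rewrite negb_or ctb ur utb !andbT; apply/andP; split.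
    by apply/negP => /rW; rewrite mem_head.
  apply/hasPn => v vb; apply/negP => /rW.
  by rewrite inE mem_cat vb !orbT.
(* If [r] and [b] were both empty, the ear would be the very edge from [t] to [c] that closes the
   old cycle, against disjointness. *)
have ss2 : (1 < size (r ++ t :: b))%N.
  rewrite size_cat /= addnS ltnS lt0n addn_eq0 !size_eq0; apply/negP => /andP[/eqP r0 /eqP b0].
  move: pr; rewrite r0 /= => /andP[/adjP[e _ eE] _].
  have : e \in set0.
    rewrite -disjE in_setI catE walk_edges_cat last_rcons r0 b0 /= !inE eE eqxx.
    by rewrite [[set t; c]]setUC eqxx orbT.
  by rewrite in_set0.
have ps2 : path adj c (rcons (r ++ t :: b) c) by rewrite catE cat_path last_rcons pr.
have [C2 [V2 E2 S2]] := seq_wcycle us2 ss2 ps2.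
have up : uniq (t :: rcons b c).
  move: us; rewrite /= mem_cat inE rcons_uniq mem_rcons inE cat_uniq.
  case/andP=> /norP[_ /norP[ct cb]] /and3P[_ _ /= /andP[tb ub]].
  by rewrite negb_or eq_sym ct tb cb.
have [P [Pl _ PV PE _]] := seq_wpath up pb.
exists (cycle_edges C1 :|: cycle_edges C2); last by rewrite subUset S1.
constructor 3; exists C1, C2, P; split; [exact: no_balanced|exact: no_balanced| |by []].
split; first by rewrite Pl size_rcons.
- rewrite V1 V2 PV; apply/setP => v; rewrite !inE !mem_cat !inE mem_rcons inE.
  have [vr|_] := boolP (v \in r).
    have := rW v vr; rewrite !inE !mem_cat !inE.
    by case/norP=> /negPf-> /norP[/negPf-> /norP[/negPf-> /negPf->]].
  by case: (v \in a); case: (v == c); case: (v == t); case: (v \in b).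
- move: disjE; rewrite E1 E2 PE !catE !walk_edges_cat !last_rcons => disjE.
  by rewrite setIUr disjE set0U setIC setKU.
Qed.

Lemma search : S != set0 ->
    (forall C : wcycle D, cycle_edges C \subset S -> exists2 e, e \in S :\: cycle_edges C &
       exists2 x, x \in cycle_verts C & x \in ends D e) ->
  exists2 F, circuit_shape F & F \subset S.
Proof.
case/set0Pn=> e0 e0S exit_edge.
have [y [cy _]] := adj_ends e0S (set21 (src D e0) (tgt D e0)).
have [x0 [s0 [us0 ss0 ps0]]] := cycle_exists cy.
have [C0 [V0 E0 S0]] := seq_wcycle us0 ss0 ps0.
have [e /setDP[eS eC0] [c cV ce]] := exit_edge C0 S0.
have c0 : c \in x0 :: s0 by rewrite V0 inE in cV.
(* The cycle is rotated to start at the vertex [c] where [e] leaves it. *)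
have [i s rotE] := rot_to c0.
have us : uniq (c :: s) by rewrite -rotE rot_uniq.
have ss : (1 < size s)%N by have := congr1 size rotE; rewrite size_rot /= => -[<-].
have ps : path adj c (rcons s c).
  by have : cycle adj (c :: s) by rewrite -rotE rot_cycle.
have [C1 [V1 E1 S1]] := seq_wcycle us ss ps.
have eC1 : e \notin cycle_edges C1.
  rewrite E1; apply: contra eC0 => /(walk_edges_next _ _ us)[v vs eE].
  rewrite E0; apply/(walk_edges_next _ _ us0); exists v.
    by rewrite -(mem_rot i) rotE.
  by rewrite -(next_rot i us0) rotE.
have [z [cz eE]] := adj_ends eS ce.
have zc : z != c by rewrite eq_sym (adj_neq cz).
have theta r t : path adj c (rcons r t) -> uniq r -> {in r, forall v, v \notin c :: s} ->
    t \in s -> walk_edges D c (rcons s c) :&: walk_edges D c (rcons r t) = set0 ->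
    exists2 F, circuit_shape F & F \subset S.
  move=> pr ur rW ts; case/splitPr: ts us ss ps rW => a b us ss ps rW.
  exact: theta_shape.
(* If the other end of [e] lies on the cycle, [e] is a chord: an ear without inner vertices. *)
have [zs|zs] := boolP (z \in s).
  apply: (theta [::] z) => //=; first by rewrite cz.
  rewrite setU0 -E1; apply/setP => e'; rewrite !inE; apply/negP => /andP[e'1 /eqP e'E].
  have e'e : e' = e by apply: (@ends_inj _ _ D); rewrite e'E.
  by rewrite -e'e e'1 in eC1.
have cW : c \in cycle_verts C1 by rewrite V1 inE mem_head.
have zW : z \notin cycle_verts C1 by rewrite V1 !inE (negPf zc).
have [r [t [pr ur rW]]] := ear cW cz zW.
have rs v : v \in r -> v \notin c :: s by move/rW; rewrite V1 inE.
have cr : c \notin r by apply/negP => /rW; rewrite cW.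
case=> [[tW tc r0]|[tc r1]|[r1 [r2 [rE r2_gt1]]]].
(* The ear returns at another vertex of the cycle: two cycles sharing a path. *)
- apply: (theta r t) => //; first by move: tW; rewrite V1 !inE (negPf tc).
  rewrite -E1; apply/setP => e'; rewrite in_set0 inE; apply/negP => /andP[/ends_cycle e'W].
  case/(walk_edges_inner r0) => v /rW vW ve.
  by rewrite (subsetP e'W) in vW.
(* The ear returns at [c]: two cycles sharing a vertex. *)
- have uc : uniq (c :: r) by rewrite /= cr.
  rewrite tc in pr; have [C2 [V2 E2 S2]] := seq_wcycle uc r1 pr.
  exists (cycle_edges C1 :|: cycle_edges C2); last by rewrite subUset S1.
  constructor 2; exists C1, C2; split; [exact: no_balanced|exact: no_balanced| |by []].
  exists c; rewrite V1 V2; apply/setP => v; rewrite !inE.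
  have [->|vc] //= := eqVneq v c.
  by apply/negP => /andP[vs /rs]; rewrite inE vs orbT.
(* The walk meets itself at [t]: its part up to [t] is the connecting path, and [t :: r2] is the
   second cycle. *)
move: pr ur rs cr; rewrite rE rcons_cat /= -cat_rcons cat_path last_rcons cat_uniq.
case/andP=> pP pC /and3P[ur1 r12 ut] rs cr.
have [C2 [V2 E2 S2]] := seq_wcycle ut r2_gt1 pC.
have uP : uniq (c :: rcons r1 t).
  move: cr r12; rewrite mem_cat !inE /= !negb_or => /and3P[cr1 ct _] /andP[tr1 _].
  by rewrite rcons_uniq mem_rcons inE negb_or ct cr1 tr1.
have [P [Pl [P0 P1] PV PE SP]] := seq_wpath uP pP.
exists (cycle_edges C1 :|: path_edges P :|: cycle_edges C2); last by rewrite !subUset S1 SP.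
constructor 4; exists C1, C2, P; split; [exact: no_balanced|exact: no_balanced| |by []].
rewrite /connected_by P0 P1 last_rcons Pl size_rcons V1 V2 PV !inE !eqxx /=; split=> //.
- rewrite -setI_eq0; apply/eqP/setP => v; rewrite in_setI in_set0 !in_set.
  by apply/negP => /andP[v1 v2]; have := rs v; rewrite mem_cat v2 orbT v1 => /(_ isT).
apply/setP => v; rewrite !inE mem_rcons inE.
have [->|vc] //= := eqVneq v c; have [->|vt] /= := eqVneq v t; first by rewrite orbT.
apply/negP => /andP[v1 /orP[vs|v2]].
  by have := rs v; rewrite mem_cat v1 !inE vs orbT => /(_ isT).
by move/hasPn: r12 => /(_ v); rewrite inE v2 orbT v1 => /(_ isT).
Qed.

End Search.
End CircuitSubgraphs.

(** * Configurations in the support of a kernel vector *)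

Section RelationSupport.
Variables (n m : nat) (D : wograph n m).
Variables (F : {set 'I_m}) (z : 'cV[int]_m).
Hypothesis zR : relation D F z.
Let S : {set 'I_m} := [set e | z e 0 != 0].

(** If [e] were the only edge of the support at [x], the equation at [x] would reduce to a single
    nonzero term. *)
Lemma relation_min_degree2 e x : e \in S -> x \in ends D e ->
  exists e', [/\ e' \in S, e' != e & x \in ends D e'].
Proof.
rewrite inE => ze xe.
have [/existsP[e' /and3P[]]|] :=
    boolP [exists e', [&& e' \in S, e' != e & x \in ends D e']]; first by exists e'.
rewrite negb_exists => /forallP none; case/eqP: ze.
have := relation_sum zR x; rewrite (bigD1 e) //= big1 ?addr0 => [|e' e'e].
  by move/eqP; rewrite mulf_eq0 incidence_eq0 xe => /eqP.
have := none e'; rewrite e'e inE !negb_and !negbK /= -incidence_eq0.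
by case/orP=> /eqP->; rewrite ?mulr0 ?mul0r.
Qed.

(* Otherwise z restricted to C would be a nonzero kernel vector of the
   nonsingular matrix A(C). *)
Lemma unbalanced_exit (C : wcycle D) : cycle_edges C \subset S -> unbalanced C ->
  exists2 e, e \in S :\: cycle_edges C &
    exists2 x, x \in cycle_verts C & x \in ends D e.
Proof.
move=> CS unb.
have [/exists_inP[e eSC /exists_inP[x xC xe]]|] :=
    boolP [exists e in S :\: cycle_edges C, [exists x in cycle_verts C, x \in ends D e]].
  by exists e => //; exists x.
rewrite negb_exists => /forallP none; case: unb; rewrite /balanced.
pose w : 'cV[int]_(clen C) := \col_i z (cedge i) 0.
have Mw : cycle_incidence C *m w = 0.
  apply/colP => j; rewrite mxE [RHS]mxE -[RHS](relation_sum zR (cvtx j)).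
  rewrite [RHS](bigID (mem (cycle_edges C))) /= [X in _ = _ + X]big1 ?addr0 => [|e eC].
    rewrite big_imset /=; last by move=> i i' _ _; apply: cedge_inj.
    by apply: eq_big => [i|i _]; rewrite ?inE // [w _ _]mxE [cycle_incidence _ _ _]mxE.
  have := none e; rewrite inE eC inE /=; have [->|ze] /= := eqVneq (z e 0) 0.
    by rewrite mulr0.
  rewrite negb_exists => /forallP/(_ (cvtx j)); rewrite mem_cvtx /= -incidence_eq0.
  by move/eqP->; rewrite mul0r.
have := congr1 (mulmx (\adj (cycle_incidence C))) Mw.
rewrite mulmxA mul_adj_mx mulmx0 mul_scalar_mx => /colP dw.
pose i := Ordinal (ltn_trans (ltn0Sn 1) (clen_gt2 C)).
have := dw i; rewrite !mxE => /eqP; rewrite mulf_eq0 => /orP[/eqP//|/eqP zi].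
by have := subsetP CS _ (mem_cedge i); rewrite inE zi eqxx.
Qed.

Lemma relation_circuit_shape : z != 0 -> exists2 G, circuit_shape D G & G \subset S.
Proof.
move=> z0.
have [[C [bC CS]]|none] := excluded_middle_informative
    (exists C : wcycle D, balanced C /\ cycle_edges C \subset S).
  by exists (cycle_edges C) => //; constructor 1; exists C.
have unb (C : wcycle D) : cycle_edges C \subset S -> unbalanced C.
  by move=> CS bC; apply: none; exists C.
apply: search => //; first exact: relation_min_degree2.
  have [e ze] : exists e, z e 0 != 0.
    by case/cV0Pn: z0 => e ze; exists e.
  by apply/set0Pn; exists e; rewrite inE.
by move=> C CS; apply: unbalanced_exit CS (unb C CS).
Qed.

End RelationSupport.

(** * From circuit binomials to configurations *)

(** Only an inclusion: a variable with equal positive exponents in both monomials can lie in the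
    support of the binomial but not in that of the difference. *)
Lemma binomial_exp_diff_support (K : fieldType) (m : nat) (u v : 'X_{1..m}) :
  [set e | exp_diff u v e 0 != 0] \subset msupport ('X_[K, u] - 'X_[v]).
Proof.
apply/subsetP => e; rewrite inE mxE subr_eq0 eqz_nat => uve.
have uv : u != v by apply: contraNneq uve => ->.
have [ue0|ue0] := eqVneq (u e) 0%N; apply/msupportP; [exists v | exists u] => //.
- by rewrite mcoeff_msupp mcoeffB !mcoeffX eqxx (negPf uv) sub0r oppr_eq0 oner_eq0.
- by move: uve; rewrite ue0 eq_sym.
- by rewrite mcoeff_msupp mcoeffB !mcoeffX eqxx [v == u]eq_sym (negPf uv) subr0 oner_eq0.
Qed.

(** The exponent difference of a circuit is a nonzero relation, so its support contains a
    configuration, and minimality identifies the circuit with the generator found there. Conversely,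
    every configuration has a kernel of rank one. *)
Lemma circuit_iff_shape (K : fieldType) (n m : nat) (D : wograph n m) (f : {mpoly K[m]}) :
  circuit D f <->
  exists2 F, circuit_shape D F & eq_up_to_sign f (toric_gen K D F).
Proof.
split=> [cf | [F /circuit_shape_kernel_line kl []->]]; last first.
- exact/circuit_opp/toric_gen_circuit.
- exact: toric_gen_circuit.
have [[f0 [u [v fE]]] fI _ _] := cf.
have uv : u != v by rewrite -(binomial_neq0 K) -fE; apply/eqP.
have zR : relation D setT (exp_diff u v).
  split; last by move=> e; rewrite inE.
  by apply/vertex_exp_eq/(toric_ideal_binomial K); rewrite -fE.
have z0 : exp_diff u v != 0.
  apply: contraNneq uv => /colP z0; apply/eqP/mnmP => e; apply/eqP.
  by rewrite -eqz_nat -subr_eq0; have := z0 e; rewrite !mxE => ->.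
have [F shF FS] := relation_circuit_shape zR z0; exists F => //.
apply: circuit_toric_gen cf; first exact: circuit_shape_kernel_line.
by rewrite fE; apply: subset_trans FS (binomial_exp_diff_support K u v).
Qed.

Theorem theorem3p4 (K : fieldType) (n m : nat) (D : wograph n m)
    (f : {mpoly K[m]}) :
  circuit D f <->
  [\/ exists C : wcycle D,
        balanced C /\ eq_up_to_sign f (toric_gen K D (cycle_edges C)),
      exists C1 C2 : wcycle D,
        [/\ unbalanced C1, unbalanced C2, share_vertex C1 C2 &
            eq_up_to_sign f
              (toric_gen K D (cycle_edges C1 :|: cycle_edges C2))],
      exists (C1 C2 : wcycle D) (P : wpath D),
        [/\ unbalanced C1, unbalanced C2, share_path C1 C2 P &
            eq_up_to_sign f
              (toric_gen K D (cycle_edges C1 :|: cycle_edges C2))] |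
      exists (C1 C2 : wcycle D) (P : wpath D),
        [/\ unbalanced C1, unbalanced C2, connected_by C1 C2 P &
            eq_up_to_sign f
              (toric_gen K D
                 (cycle_edges C1 :|: path_edges P :|: cycle_edges C2))]].
Proof.
split=> [/circuit_iff_shape[F sh fE] | sh].
  case: sh fE => [[C [bC ->]]|[C1 [C2 [u1 u2 sh ->]]]|[C1 [C2 [P [u1 u2 sh ->]]]]|
                  [C1 [C2 [P [u1 u2 sh ->]]]]] fE.
  - by constructor 1; exists C.
  - by constructor 2; exists C1, C2.
  - by constructor 3; exists C1, C2, P.
  - by constructor 4; exists C1, C2, P.
apply/circuit_iff_shape.
case: sh => [[C [bC fE]]|[C1 [C2 [u1 u2 sh fE]]]|[C1 [C2 [P [u1 u2 sh fE]]]]|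
             [C1 [C2 [P [u1 u2 sh fE]]]]].
- by exists (cycle_edges C) => //; constructor 1; exists C.
- by exists (cycle_edges C1 :|: cycle_edges C2) => //; constructor 2; exists C1, C2.
- by exists (cycle_edges C1 :|: cycle_edges C2) => //; constructor 3; exists C1, C2, P.
- exists (cycle_edges C1 :|: path_edges P :|: cycle_edges C2) => //.
  by constructor 4; exists C1, C2, P.
Qed.
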